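(* Let $N\ge 1$, $R>0$, $m>1$ with $N>m$, $p>1$, $\alpha,\beta\in\mathbb R$ and $\gamma\in(0,m-1)$. Assume: (H0) $N+\alpha-m>0$ and $\beta-\alpha+1>0$; (H1) $m-1<p<m^*_{\alpha,\beta,\gamma}-1$ and $0<\gamma<\Upsilon$, where $$m^*_{\alpha,\beta,\gamma}=\frac{m(m-1)(N+\beta)-\gamma[m(N+\beta+1)-N-\alpha]}{(m-1)(N+\alpha-m)},\qquad \Upsilon=\frac{m(m-1)(\beta-\alpha+m)}{m(N+\beta+1)-N-\alpha};$$ (H2) $g:[0,\infty)\to[0,\infty)$ is continuous, nondecreasing and $\lim_{v\to\infty}g(v)/v=1$; (H3) $a:[0,\infty)\to(0,\infty)$ is continuous and there are constants $0<c_1\le c_2$ with $c_1\le a(t)\le c_2$ for all $t\ge0$. Then the problem $$-\mathrm{div}\Big(\frac{|x|^\alpha|\nabla u|^{m-2}\nabla u}{(a(|x|)+g(u))^\gamma}\Big)=|x|^\beta u^p \ \text{in } B_R\setminus\{0\},\qquad u=0 \text{ on }\partial B_R$$ has at least one positive radial solution.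
   Context: $B_R$ is the open ball of radius $R$ centered at the origin in $\mathbb R^N$. A positive radial solution is a function $u(x)=v(|x|)$ with $v>0$ on $[0,R)$ such that $v\in C^1[0,R)\cap C[0,R]$, the function $r\mapsto r^{N+\alpha-1}|v'(r)|^{m-2}v'(r)\,[a(r)+g(v(r))]^{-\gamma}$ belongs to $C^1(0,R)$, and $v$ satisfies $$-\Big(\frac{r^{N+\alpha-1}|v'(r)|^{m-2}v'(r)}{(a(r)+g(v(r)))^\gamma}\Big)'=r^{N+\beta-1}v^p(r),\ 0<r<R,\qquad v'(0)=0,\ v(R)=0.$$ *)

(* Defs.v *)
From Stdlib Require Import Reals Lra.
From Coquelicot Require Import Coquelicot.
Open Scope R_scope.

(* The map s |-> |s|^(m-2) s, extended continuously by 0 at s = 0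
   (for m > 1 this is the standard convention; Rpower 0 _ is not meaningful). *)
Definition phi_m (m s : R) : R :=
  if Req_EM_T s 0 then 0 else Rpower (Rabs s) (m - 2) * s.

Definition mstar (N m alpha beta gamma : R) : R :=
  (m * (m - 1) * (N + beta) - gamma * (m * (N + beta + 1) - N - alpha))
  / ((m - 1) * (N + alpha - m)).

Definition Upsilon (N m alpha beta : R) : R :=
  m * (m - 1) * (beta - alpha + m) / (m * (N + beta + 1) - N - alpha).

Definition flux (N m alpha gamma : R) (a g v dv : R -> R) (r : R) : R :=
  Rpower r (N + alpha - 1) * phi_m m (dv r) / Rpower (a r + g (v r)) gamma.

(* positive radial solution on B_R in the sense of the paper, u(x) = v(|x|) *)
Definition positive_radial_solution (N m alpha beta gamma p Rad : R)
    (a g v : R -> R) : Prop :=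
  (forall r, 0 <= r < Rad -> 0 < v r) /\
  exists dv : R -> R,
    (* v in C^1[0,R): derivative dv on (0,R), right derivative at 0,
       dv continuous on [0,R) (right-continuous at 0) *)
    (forall r, 0 < r < Rad -> is_derive v r (dv r)) /\
    filterlim (fun h => (v h - v 0) / h) (at_right 0) (locally (dv 0)) /\
    (forall r, 0 < r < Rad -> continuous dv r) /\
    filterlim dv (at_right 0) (locally (dv 0)) /\
    filterlim v (at_left Rad) (locally (v Rad)) /\
    dv 0 = 0 /\ v Rad = 0 /\
    exists dw : R -> R,
      forall r, 0 < r < Rad ->
        is_derive (flux N m alpha gamma a g v dv) r (dw r) /\
        continuous dw r /\
        - dw r = Rpower r (N + beta - 1) * Rpower (v r) p.

(* Main.v *)
Require Import Defs.
From Stdlib Require Import Reals.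
From Coquelicot Require Import Coquelicot.
From Stdlib Require Import Lra Lia Classical IndefiniteDescription.
From mathcomp Require classical.filter.
Open Scope R_scope.

(** Shooting. Writing A = N + alpha - 1, B = N + beta - 1 and e = 1 / (m - 1), a radial solution solves
      v' = - (r^(-A) (a + g(v))^gamma W)^e,   W' = r^B v^p,   v(0) = D,   W(0) = 0,
    and we look for an initial height D with v(Rad) = 0. As a and g are only continuous, the initial
    value problem may have several solutions; the shooting is therefore done on Euler schemes, whose
    endpoint depends continuously on D, and the mesh is sent to 0 along an ultrafilter.
    For small D the endpoint is positive because p > m - 1. For a suitable large D no solution is
    positive on [0, Rad): rescaling to w(y) = v(lam y) / D turns such a solution, on a long interval,
    into a small perturbation of a positive solution of the equation with a = 0 and g(w) = w, which a
    Pohozaev identity excludes because p is subcritical. Hence along the ultrafilter either the Euler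
    endpoint at D is nonpositive, and the intermediate value theorem gives heights whose endpoint is 0,
    or the limit of the schemes started at D is an excluded positive solution. *)

(** * Ultralimits and real powers *)

(** The substitution [z = w^(1-th)], with [th = gamma / (m - 1)], governs the exponents. When
    [a = 0] and [g(w) = w] it turns the equation into the weighted Emden-Fowler equation
    [-(y^A |z'|^(m-2) z')' = const * y^B z^q] with [q = p / (1-th)], and [p < mstar - 1] is exactly
    its subcriticality [q + 1 < m (B+1) / (A+1-m)]. After rescaling, the true coefficient is close
    to its limit only where [v] is large; at bounded heights only crude two-sided bounds are known.
    The profile to be excluded must therefore stay above a level [eta] on the interval used, and
    [eta] must be known before the height [D] is chosen. This is why the nonexistence result is
    quantitative: compactness is replaced by explicit bounds, and the constants are fixed in the
    order [L], [eta], [eps], [D]. The level comes from asking for positivity on [[0, 2L]]: a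
    decreasing profile that is still positive at [2L] cannot be too small on [[0, L]]. *)

Record free_ultrafilter (G : (nat -> Prop) -> Prop) : Prop := {
  ultra_mono : forall P Q : nat -> Prop, (forall n, P n -> Q n) -> G P -> G Q;
  ultra_and : forall P Q : nat -> Prop, G P -> G Q -> G (fun n => P n /\ Q n);
  ultra_ex : forall P : nat -> Prop, G P -> exists n, P n;
  ultra_em : forall P : nat -> Prop, G P \/ G (fun n => ~ P n);
  ultra_tail : forall n0 : nat, G (fun n => (n0 <= n)%nat) }.

(** An ultrafilter extending the Frechet filter [F] of eventually true properties. *)
Lemma free_ultrafilter_ex : exists G, free_ultrafilter G.
Proof.
pose (F := fun P : nat -> Prop => exists n0, forall n, (n0 <= n)%nat -> P n).
assert (HF : filter.ProperFilter F).
{ constructor.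
  - intros [n0 H]. exact (H n0 (le_n n0)).
  - constructor.
    + exists 0%nat. intros n _. exact I.
    + intros P Q [n1 H1] [n2 H2]. exists (max n1 n2). intros n Hn.
      split; [apply H1 | apply H2]; lia.
    + intros P Q HPQ [n1 H1]. exists n1. intros n Hn. apply HPQ, H1, Hn. }
destruct (filter.ultraFilterLemma HF) as [G [HU HFG]].
pose proof (@filter.ultra_proper _ _ HU) as HP.
pose proof (@filter.filter_filter _ _ HP) as HG.
exists G. constructor.
- intros P Q HPQ HGP. exact (filter.filterS HPQ HGP).
- intros P Q HGP HGQ. exact (filter.filterI HGP HGQ).
- intros P HGP. apply NNPP. intros Hn. apply (filter.filter_not_empty G).
  refine (filter.filterS _ HGP). intros n Hn'. apply Hn. exists n. exact Hn'.
- intros P. exact (filter.in_ultra_setVsetC P HU).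
- intros n0. apply HFG. exists n0. auto.
Qed.

Definition ulim (G : (nat -> Prop) -> Prop) (u : nat -> R) (l : R) : Prop :=
  forall eps, 0 < eps -> G (fun n => Rabs (u n - l) < eps).

(** The limit is the supremum of the levels that lie below [u] on a large set of indices. One [G]
    serves all bounded sequences, so limits at every point of an interval exist at once, without
    extracting subsequences. *)
Lemma ulim_ex (G : (nat -> Prop) -> Prop) (HG : free_ultrafilter G) (u : nat -> R) (lo hi : R) :
  (forall n, lo <= u n <= hi) -> exists l, ulim G u l.
Proof.
intros Hu.
pose (E := fun x => G (fun n => x <= u n)).
destruct (completeness E) as [l [Hub Hlub]].
- exists hi. intros x Hx. destruct (ultra_ex G HG _ Hx) as [n Hn]. generalize (Hu n); lra.
- exists lo. apply (ultra_mono G HG (fun n => (0 <= n)%nat)).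
  + intros n _. apply Hu.
  + apply (ultra_tail G HG).
- exists l. intros eps He.
  assert (H1 : G (fun n => l - eps < u n)).
  { apply NNPP. intros Hn. apply (Rlt_irrefl l). apply Rle_lt_trans with (l - eps); [|lra].
    apply Hlub. intros x Hx. apply Rnot_lt_le. intros Hlt. apply Hn.
    apply (ultra_mono G HG _ _) with (2 := Hx). intros n; lra. }
  assert (H2 : G (fun n => u n < l + eps)).
  { destruct (ultra_em G HG (fun n => l + eps / 2 <= u n)) as [H|H].
    - exfalso. generalize (Hub _ H). lra.
    - apply (ultra_mono G HG _ _) with (2 := H). intros n; lra. }
  apply (ultra_mono G HG _ _) with (2 := ultra_and G HG _ _ H1 H2).
  intros n [Ha Hb]. apply Rabs_lt_between'. lra.
Qed.

Lemma ulim_le (G : (nat -> Prop) -> Prop) (HG : free_ultrafilter G) (u : nat -> R) (l c : R) :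
  ulim G u l -> G (fun n => u n <= c) -> l <= c.
Proof.
intros Hu Hc. apply Rle_plus_epsilon. intros eps He.
destruct (ultra_ex G HG _ (ultra_and G HG _ _ Hc (Hu eps He))) as [n [H1 H2]].
apply Rabs_lt_between' in H2. lra.
Qed.

Lemma ulim_ge (G : (nat -> Prop) -> Prop) (HG : free_ultrafilter G) (u : nat -> R) (l c : R) :
  ulim G u l -> G (fun n => c <= u n) -> c <= l.
Proof.
intros Hu Hc. apply Rle_plus_epsilon. intros eps He.
destruct (ultra_ex G HG _ (ultra_and G HG _ _ Hc (Hu eps He))) as [n [H1 H2]].
apply Rabs_lt_between' in H2. lra.
Qed.

(** * Powers truncated at 0, and calculus with them *)

(* Unlike [Rpower], whose value at x <= 0 is 1, this is continuous in x on the whole line for y > 0. *)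
Definition pw (x y : R) : R := if Rlt_dec 0 x then Rpower x y else 0.

Lemma pw_Rpower x y : 0 < x -> pw x y = Rpower x y.
Proof. intros Hx. unfold pw. destruct (Rlt_dec 0 x); [reflexivity | lra]. Qed.

Lemma pw_npos x y : x <= 0 -> pw x y = 0.
Proof. intros Hx. unfold pw. destruct (Rlt_dec 0 x); [lra | reflexivity]. Qed.

Lemma pw_pos x y : 0 < x -> 0 < pw x y.
Proof. intros Hx. rewrite pw_Rpower by assumption. apply exp_pos. Qed.

Lemma pw_ge0 x y : 0 <= pw x y.
Proof. unfold pw. destruct (Rlt_dec 0 x); [apply Rlt_le, exp_pos | lra]. Qed.

Lemma pw_1 y : pw 1 y = 1.
Proof. rewrite pw_Rpower by lra. unfold Rpower. rewrite ln_1, Rmult_0_r. apply exp_0. Qed.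

Lemma pw_x1 x : 0 <= x -> pw x 1 = x.
Proof.
intros [Hx|Hx]; [rewrite pw_Rpower by easy; now apply Rpower_1 |].
rewrite pw_npos; lra.
Qed.

Lemma pw_x0 x : 0 < x -> pw x 0 = 1.
Proof. intros Hx. rewrite pw_Rpower by easy. now apply Rpower_O. Qed.

Lemma pw_le x x' y : 0 <= y -> x <= x' -> pw x y <= pw x' y.
Proof.
intros Hy Hx. destruct (Rlt_le_dec 0 x).
- rewrite !pw_Rpower by lra. apply Rle_Rpower_l; lra.
- rewrite (pw_npos x) by easy. apply pw_ge0.
Qed.

Lemma pw_le1 x y : 0 <= y -> x <= 1 -> pw x y <= 1.
Proof. intros Hy Hx. apply Rle_trans with (pw 1 y); [now apply pw_le | rewrite pw_1; lra]. Qed.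

Lemma pw_lt x x' y : 0 < y -> 0 <= x -> x < x' -> pw x y < pw x' y.
Proof.
intros Hy Hx Hxx. destruct Hx as [Hx|Hx].
- rewrite !pw_Rpower by lra. now apply Rlt_Rpower_l.
- rewrite (pw_npos x) by lra. apply pw_pos; lra.
Qed.

Lemma pw_mult x x' y : 0 <= x -> 0 <= x' -> pw (x * x') y = pw x y * pw x' y.
Proof.
intros [Hx|Hx] [Hx'|Hx'].
- rewrite !pw_Rpower by (try apply Rmult_lt_0_compat; easy). now apply eq_sym, Rpower_mult_distr.
- subst. rewrite Rmult_0_r, !(pw_npos 0) by lra. ring.
- subst. rewrite Rmult_0_l, !(pw_npos 0) by lra. ring.
- subst. rewrite Rmult_0_l, !(pw_npos 0) by lra. ring.
Qed.

Lemma pw_pw x y z : pw (pw x y) z = pw x (y * z).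
Proof.
destruct (Rlt_le_dec 0 x).
- rewrite (pw_Rpower x y), (pw_Rpower x (y * z)) by easy.
  rewrite pw_Rpower by apply exp_pos. apply Rpower_mult.
- rewrite !(pw_npos x) by easy. apply pw_npos; lra.
Qed.

Lemma pw_plus x y z : pw x (y + z) = pw x y * pw x z.
Proof.
destruct (Rlt_le_dec 0 x).
- rewrite !pw_Rpower by easy. apply Rpower_plus.
- rewrite !(pw_npos x) by easy. ring.
Qed.

Lemma pw_plus1 x y : 0 <= x -> pw x (y + 1) = pw x y * x.
Proof. intros Hx. rewrite pw_plus, pw_x1; easy. Qed.

Lemma pw_opp x y : 0 < x -> pw x (- y) = / pw x y.
Proof. intros Hx. rewrite !pw_Rpower by easy. apply Rpower_Ropp. Qed.

Lemma pw_inv_l x y : 0 < x -> pw (/ x) y = pw x (- y).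
Proof.
intros Hx. rewrite <- (pw_x1 x) at 1 by lra. rewrite <- pw_opp by easy.
rewrite pw_pw. f_equal. ring.
Qed.

Lemma is_derive_pw (x y : R) : 0 < x -> is_derive (fun t => pw t y) x (y * pw x (y - 1)).
Proof.
intros Hx. apply is_derive_ext_loc with (fun t => Rpower t y).
- exists (mkposreal x Hx). intros t Ht. rewrite pw_Rpower; [reflexivity|].
  unfold ball in Ht; simpl in Ht. unfold AbsRing_ball, abs, minus, plus, opp in Ht; simpl in Ht.
  apply Rabs_lt_between' in Ht. lra.
- rewrite pw_Rpower by easy. apply is_derive_Reals. now apply derivable_pt_lim_power.
Qed.

Lemma is_derive_pw_comp (f : R -> R) (x y df : R) : 0 < f x -> is_derive f x df ->
  is_derive (fun t => pw (f t) y) x (y * pw (f x) (y - 1) * df).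
Proof.
intros Hf Hd. evar_last.
- apply (is_derive_comp (fun t => pw t y) f); [now apply is_derive_pw | exact Hd].
- simpl. unfold scal; simpl; unfold mult; simpl. ring.
Qed.

Lemma is_derive_continuous (f : R -> R) (x d : R) : is_derive f x d -> continuous f x.
Proof. intros H. apply (ex_derive_continuous f). now exists d. Qed.

Lemma continuous_pw_pos (x y : R) : 0 < x -> continuous (fun t => pw t y) x.
Proof. intros Hx. eapply is_derive_continuous. now apply is_derive_pw. Qed.

Lemma continuous_pw (x y : R) : 0 < y -> continuous (fun t => pw t y) x.
Proof.
intros Hy. destruct (Rlt_le_dec 0 x) as [Hx|[Hx|Hx]].
- now apply continuous_pw_pos.
- apply continuous_ext_loc with (fun _ => 0).
  + assert (Hx' : 0 < - x) by lra. exists (mkposreal _ Hx'). intros t Ht. rewrite pw_npos; [reflexivity|].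
    unfold ball in Ht; simpl in Ht. unfold AbsRing_ball, abs, minus, plus, opp in Ht; simpl in Ht.
    apply Rabs_lt_between' in Ht. lra.
  + apply continuous_const.
- subst. unfold continuous. rewrite (pw_npos 0) by lra.
  apply filterlim_locally. intros eps.
  assert (Hd : 0 < pw eps (/ y)) by (apply pw_pos, cond_pos).
  exists (mkposreal _ Hd). intros t Ht.
  unfold ball in Ht |- *; simpl in Ht |- *.
  unfold AbsRing_ball, abs, minus, plus, opp in Ht |- *; simpl in Ht |- *.
  apply Rabs_lt_between' in Ht. rewrite Ropp_0, Rplus_0_r, Rabs_pos_eq by apply pw_ge0.
  destruct (Rlt_le_dec 0 t).
  + apply Rlt_le_trans with (pw (pw eps (/ y)) y).
    * apply pw_lt; lra.
    * rewrite pw_pw, Rinv_l, pw_x1 by (try lra; apply Rlt_le, cond_pos). apply Rle_refl.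
  + rewrite pw_npos by easy. apply cond_pos.
Qed.

Lemma continuous_pw_comp {T : UniformSpace} (f : T -> R) (x : T) (y : R) :
  0 < y -> continuous f x -> continuous (fun t => pw (f t) y) x.
Proof.
intros Hy Hf. apply (continuous_comp f (fun t => pw t y)); [exact Hf | now apply continuous_pw].
Qed.

Lemma continuous_pw_comp_pos {T : UniformSpace} (f : T -> R) (x : T) (y : R) :
  0 < f x -> continuous f x -> continuous (fun t => pw (f t) y) x.
Proof.
intros Hy Hf. apply (continuous_comp f (fun t => pw t y)); [exact Hf | now apply continuous_pw_pos].
Qed.

(* Only interior differentiability is required, so that power weights singular at an endpoint are allowed. *)
Lemma nondecreasing_of_derive (f df : R -> R) (a b : R) : a <= b ->
  (forall x, a <= x <= b -> continuous f x) ->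
  (forall x, a < x < b -> is_derive f x (df x)) ->
  (forall x, a < x < b -> 0 <= df x) -> f a <= f b.
Proof.
intros [Hab|Hab] Hc Hd Hp; [|subst; lra].
(* [MVT_gen] may return an endpoint as intermediate point, where nothing is known about [df]; the
   value 0 there is harmless. *)
pose (df' := fun x => if Rlt_dec a x then if Rlt_dec x b then df x else 0 else 0).
destruct (MVT_gen f a b df') as [c [H1 H2]].
- intros x Hx. rewrite Rmin_left, Rmax_right in Hx by lra. unfold df'.
  destruct (Rlt_dec a x), (Rlt_dec x b); try lra. now apply Hd.
- intros x Hx. rewrite Rmin_left, Rmax_right in Hx by lra.
  apply continuity_pt_filterlim. now apply Hc.
- assert (0 <= df' c). { unfold df'. destruct (Rlt_dec a c); [destruct (Rlt_dec c b)|]; try lra. now apply Hp. }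
  assert (0 <= df' c * (b - a)) by (apply Rmult_le_pos; lra). lra.
Qed.

Lemma is_derive_Rmult (f g : R -> R) (x df dg : R) : is_derive f x df -> is_derive g x dg ->
  is_derive (fun t => f t * g t) x (df * g x + f x * dg).
Proof. intros Hf Hg. apply (is_derive_mult f g x df dg Hf Hg). intros; apply Rmult_comm. Qed.

Lemma is_derive_Rplus (f g : R -> R) (x df dg : R) : is_derive f x df -> is_derive g x dg ->
  is_derive (fun t => f t + g t) x (df + dg).
Proof. intros Hf Hg. apply (is_derive_plus f g x df dg Hf Hg). Qed.

Lemma is_derive_Rminus (f g : R -> R) (x df dg : R) : is_derive f x df -> is_derive g x dg ->
  is_derive (fun t => f t - g t) x (df - dg).
Proof. intros Hf Hg. apply (is_derive_minus f g x df dg Hf Hg). Qed.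

Lemma is_derive_Rscal (k : R) (f : R -> R) (x df : R) : is_derive f x df ->
  is_derive (fun t => k * f t) x (k * df).
Proof. intros Hf. exact (is_derive_scal f x k df Hf). Qed.

Lemma is_derive_Rcst (k x : R) : is_derive (fun _ => k) x 0.
Proof. apply (is_derive_const (K:=R_AbsRing) (V:=R_NormedModule)). Qed.

Lemma is_derive_Rid (x : R) : is_derive (fun t => t) x 1.
Proof. apply (is_derive_id (K:=R_AbsRing)). Qed.

Lemma continuous_Rmult {T : UniformSpace} (f g : T -> R) (x : T) : continuous f x -> continuous g x ->
  continuous (fun t => f t * g t) x.
Proof. intros Hf Hg. apply (continuous_mult f g x Hf Hg). Qed.

Lemma continuous_Rplus {T : UniformSpace} (f g : T -> R) (x : T) : continuous f x -> continuous g x ->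
  continuous (fun t => f t + g t) x.
Proof. intros Hf Hg. apply (continuous_plus f g x Hf Hg). Qed.

Lemma continuous_Rminus {T : UniformSpace} (f g : T -> R) (x : T) : continuous f x -> continuous g x ->
  continuous (fun t => f t - g t) x.
Proof. intros Hf Hg. apply (continuous_minus f g x Hf Hg). Qed.

Lemma continuous_Rscal (k : R) (f : R -> R) (x : R) : continuous f x ->
  continuous (fun t => k * f t) x.
Proof. intros Hf. apply continuous_Rmult; [apply continuous_const | exact Hf]. Qed.

Lemma pw_decay (x k delta : R) : 0 < x -> 0 < delta -> 0 <= k ->
  exists L0, 1 <= L0 /\ forall L, L0 <= L -> k * pw L (- x) <= delta.
Proof.
intros Hx Hd Hk.
(* Beyond this threshold [pw L x] is at least [(k + 1) / delta]; using [k + 1] keeps the base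
   positive when [k = 0]. *)
exists (Rmax 1 (pw ((k + 1) / delta) (/ x))). split; [apply Rmax_l|].
intros L HL.
assert (H1 : 1 <= L) by (eapply Rle_trans; [apply Rmax_l | exact HL]).
assert (H2 : pw ((k + 1) / delta) (/ x) <= L) by (eapply Rle_trans; [apply Rmax_r | exact HL]).
assert (Hq : 0 < (k + 1) / delta) by (apply Rdiv_lt_0_compat; lra).
apply (pw_le _ _ x) in H2; [|lra].
rewrite pw_pw, Rinv_l, pw_x1 in H2 by lra.
rewrite pw_opp by lra.
assert (Hp : 0 < pw L x) by (apply pw_pos; lra).
apply (Rmult_le_reg_r (pw L x)); [easy|].
rewrite Rmult_assoc, Rinv_l, Rmult_1_r by lra.
assert (delta * ((k + 1) / delta) <= delta * pw L x) by (apply Rmult_le_compat_l; lra).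
replace (delta * ((k + 1) / delta)) with (k + 1) in H by (field; lra). lra.
Qed.

(** * A quantitative Liouville theorem *)

Section Liouville.

Context (m A B p ga e th c3 C4 : R).
Context (Hm : 1 < m) (HA : 0 < A + 1 - m) (HB : 0 < B + 1 - A) (Hp : m - 1 < p).
Context (Hga : 0 < ga < m - 1) (He : e * (m - 1) = 1) (Hth : th = ga * e).
Context (Hsub : (p + 1 - th) * (A + 1 - m) < m * (1 - th) * (B + 1)).
Context (Hc3 : 0 < c3) (HC4 : 0 < C4).

(* [c] stands for (a + g(v)) / D after rescaling; it equals w in the limit equation. *)
Record rescaled_solution (L eta eps : R) (w U c : R -> R) : Prop := {
  rs_w0 : w 0 = 1;
  rs_U0 : U 0 = 0;
  rs_wc : forall y, 0 <= y <= 2 * L -> continuous w y;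
  rs_Uc : forall y, 0 <= y <= 2 * L -> continuous U y;
  rs_wpos : forall y, 0 <= y <= 2 * L -> 0 < w y;
  rs_dw : forall y, 0 < y < 2 * L -> is_derive w y (- pw (pw y (- A) * pw (c y) ga * U y) e);
  rs_dU : forall y, 0 < y < 2 * L -> is_derive U y (pw y B * pw (w y) p);
  rs_clow : forall y, 0 < y < 2 * L -> c3 * w y <= c y;
  rs_chigh : forall y, 0 < y < 2 * L -> c y <= C4;
  rs_near : forall y, 0 < y < L -> eta <= w y -> Rabs (pw (c y / w y) th - 1) <= eps }.

Lemma e_pos : 0 < e.
Proof. apply (Rmult_lt_reg_r (m - 1)); lra. Qed.

Lemma th_bounds : 0 < th < 1.
Proof.
pose proof e_pos. rewrite Hth. split; [apply Rmult_lt_0_compat; lra|].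
rewrite <- He, Rmult_comm. apply Rmult_lt_compat_l; lra.
Qed.

(** The quotient [s = nu_exp / tau_exp] is the scaling exponent of the limit equation:
    [l^s * w(l y)] solves it whenever [w] does. *)
Definition nu_exp := (B + 1 - A) * e + 1.
Definition tau_exp := th + p * e - 1.
(** [w_lip] bounds the slope of [w] on [[0, 1]]. Hence [w >= 1/2] on [[0, y_half]] and
    [U y_half >= U_floor], uniformly over all rescaled solutions. *)
Definition w_lip := pw C4 th * pw (/ (B + 1)) e.
Definition y_half := Rmin 1 (/ (2 * w_lip)).
Definition U_floor := pw (1 / 2) p * (pw y_half (B + 1) / (B + 1)).
Definition drop_rate := (1 - th) * pw c3 th.
(** The coefficient of the source term [y^B w^(p+1-th)] in the differentiated Pohozaev functional.
    Its positivity is subcriticality, [Hsub]. *)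
Definition poh_gap := (B + 1) / (p + 1 - th) - (A + 1 - m) / m / (1 - th).
Definition poh_floor := poh_gap * pw (1 / 2) (1 - th) * U_floor.

Lemma nu_exp_gt1 : 1 < nu_exp.
Proof. unfold nu_exp. pose proof e_pos. assert (0 < (B + 1 - A) * e) by (apply Rmult_lt_0_compat; lra). lra. Qed.

Lemma tau_exp_pos : 0 < tau_exp.
Proof.
unfold tau_exp. pose proof e_pos. pose proof th_bounds.
assert ((m - 1) * e < p * e) by (apply Rmult_lt_compat_r; lra). lra.
Qed.

Lemma w_lip_pos : 0 < w_lip.
Proof. apply Rmult_lt_0_compat; apply pw_pos; [lra|]. apply Rinv_0_lt_compat; lra. Qed.

Lemma y_half_bounds : 0 < y_half <= 1.
Proof.
pose proof w_lip_pos. split; [|apply Rmin_l]. apply Rmin_glb_lt; [lra|]. apply Rinv_0_lt_compat; lra.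
Qed.

Lemma w_lip_y_half : w_lip * y_half <= 1 / 2.
Proof.
pose proof w_lip_pos. apply Rle_trans with (w_lip * / (2 * w_lip)).
- apply Rmult_le_compat_l; [lra | apply Rmin_r].
- right; field; lra.
Qed.

Lemma U_floor_pos : 0 < U_floor.
Proof.
pose proof y_half_bounds. apply Rmult_lt_0_compat; [apply pw_pos; lra|].
apply Rdiv_lt_0_compat; [apply pw_pos; lra | lra].
Qed.

Lemma drop_rate_pos : 0 < drop_rate.
Proof. pose proof th_bounds. apply Rmult_lt_0_compat; [lra | now apply pw_pos]. Qed.

Lemma poh_gap_pos : 0 < poh_gap.
Proof.
pose proof th_bounds. unfold poh_gap.
replace ((B + 1) / (p + 1 - th) - (A + 1 - m) / m / (1 - th))
  with ((m * (1 - th) * (B + 1) - (p + 1 - th) * (A + 1 - m)) / ((p + 1 - th) * (m * (1 - th))))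
  by (field; lra).
apply Rdiv_lt_0_compat; [lra|]. repeat apply Rmult_lt_0_compat; lra.
Qed.

Lemma poh_floor_pos : 0 < poh_floor.
Proof.
pose proof poh_gap_pos; pose proof U_floor_pos.
apply Rmult_lt_0_compat; [apply Rmult_lt_0_compat|]; try easy. apply pw_pos; lra.
Qed.

(** * A priori bounds on one rescaled solution *)

Section Fixed_solution.

Context (L eta eps : R) (w U c : R -> R) (HL : 1 <= L) (Hs : rescaled_solution L eta eps w U c).

(* The slope of w^(1-th) / (1-th) when c = w. *)
Definition slope y := pw y (- A * e) * pw (U y) e.

Lemma is_derive_mu y : 0 < y -> is_derive (fun t => pw t (B + 1) / (B + 1)) y (pw y B).
Proof.
intros Hy. evar_last.
- apply (is_derive_ext (fun t => / (B + 1) * pw t (B + 1))); [intros t; exact (Rmult_comm _ _)|].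
  apply is_derive_Rscal, is_derive_pw, Hy.
- replace (B + 1 - 1) with B by ring. field. lra.
Qed.

Lemma continuous_mu y : continuous (fun t => pw t (B + 1) / (B + 1)) y.
Proof.
apply (continuous_Rmult (fun t => pw t (B + 1)) (fun _ => / (B + 1))).
- apply continuous_pw; lra.
- apply continuous_const.
Qed.

Lemma U_ge0 y : 0 <= y <= 2 * L -> 0 <= U y.
Proof.
intros Hy. rewrite <- (rs_U0 _ _ _ _ _ _ Hs).
apply (nondecreasing_of_derive U (fun y => pw y B * pw (w y) p)); [lra| | |].
- intros; apply (rs_Uc _ _ _ _ _ _ Hs); lra.
- intros; apply (rs_dU _ _ _ _ _ _ Hs); lra.
- intros; apply Rmult_le_pos; apply pw_ge0.
Qed.

Lemma U_le x y : 0 <= x <= y -> y <= 2 * L -> U x <= U y.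
Proof.
intros Hx Hy.
apply (nondecreasing_of_derive U (fun y => pw y B * pw (w y) p)); [lra| | |].
- intros; apply (rs_Uc _ _ _ _ _ _ Hs); lra.
- intros; apply (rs_dU _ _ _ _ _ _ Hs); lra.
- intros; apply Rmult_le_pos; apply pw_ge0.
Qed.

Lemma w_le x y : 0 <= x <= y -> y <= 2 * L -> w y <= w x.
Proof.
intros Hx Hy. apply Ropp_le_cancel.
apply (nondecreasing_of_derive (fun y => - w y) (fun y => - - pw (pw y (- A) * pw (c y) ga * U y) e)); [lra| | |].
- intros; apply (continuous_opp w), (rs_wc _ _ _ _ _ _ Hs); lra.
- intros z Hz. apply (is_derive_opp w), (rs_dw _ _ _ _ _ _ Hs); lra.
- intros; rewrite Ropp_involutive; apply pw_ge0.
Qed.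

Lemma w_le1 y : 0 <= y <= 2 * L -> w y <= 1.
Proof. intros Hy. rewrite <- (rs_w0 _ _ _ _ _ _ Hs). apply w_le; lra. Qed.

Lemma U_upper y : 0 <= y <= 2 * L -> U y <= pw y (B + 1) / (B + 1).
Proof.
intros Hy.
assert (H := nondecreasing_of_derive (fun t => pw t (B + 1) / (B + 1) - U t)
  (fun t => pw t B - pw t B * pw (w t) p) 0 y).
cbv beta in H. rewrite (pw_npos 0), (rs_U0 _ _ _ _ _ _ Hs) in H by lra.
assert (0 / (B + 1) - 0 <= pw y (B + 1) / (B + 1) - U y); [apply H; clear H|unfold Rdiv in *; lra].
- lra.
- intros x Hx. apply continuous_Rminus; [apply continuous_mu | apply (rs_Uc _ _ _ _ _ _ Hs); lra].
- intros x Hx. apply is_derive_Rminus; [apply is_derive_mu; lra | apply (rs_dU _ _ _ _ _ _ Hs); lra].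
- intros x Hx. pose proof (w_le1 x ltac:(lra)). pose proof (pw_ge0 x B).
  assert (pw (w x) p <= 1) by (apply pw_le1; lra).
  assert (pw x B * pw (w x) p <= pw x B * 1) by (apply Rmult_le_compat_l; lra). lra.
Qed.

Lemma U_lower k y : 0 <= k -> 0 <= y <= 2 * L -> (forall x, 0 <= x <= y -> k <= w x) ->
  pw k p * (pw y (B + 1) / (B + 1)) <= U y.
Proof.
intros Hk Hy Hw.
assert (H := nondecreasing_of_derive (fun t => U t - pw k p * (pw t (B + 1) / (B + 1)))
  (fun t => pw t B * pw (w t) p - pw k p * pw t B) 0 y).
cbv beta in H. rewrite (pw_npos 0), (rs_U0 _ _ _ _ _ _ Hs) in H by lra.
assert (0 - pw k p * (0 / (B + 1)) <= U y - pw k p * (pw y (B + 1) / (B + 1))); [apply H; clear H|unfold Rdiv in *; lra].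
- lra.
- intros x Hx. apply continuous_Rminus; [apply (rs_Uc _ _ _ _ _ _ Hs); lra|].
  apply continuous_Rscal, continuous_mu.
- intros x Hx. apply is_derive_Rminus; [apply (rs_dU _ _ _ _ _ _ Hs); lra|].
  apply is_derive_Rscal, is_derive_mu; lra.
- intros x Hx. pose proof (pw_ge0 x B).
  assert (pw k p <= pw (w x) p) by (apply pw_le; [lra | apply Hw; lra]).
  assert (pw x B * pw k p <= pw x B * pw (w x) p) by (apply Rmult_le_compat_l; lra). lra.
Qed.

Lemma U_pos y : 0 < y <= 2 * L -> 0 < U y.
Proof.
intros Hy. eapply Rlt_le_trans; [|apply (U_lower (w y)); try lra].
- pose proof (rs_wpos _ _ _ _ _ _ Hs y ltac:(lra)).
  apply Rmult_lt_0_compat; [now apply pw_pos|].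
  apply Rdiv_lt_0_compat; [apply pw_pos; lra | lra].
- apply Rlt_le, (rs_wpos _ _ _ _ _ _ Hs); lra.
- intros x Hx. apply w_le; lra.
Qed.

Lemma c_pos y : 0 < y < 2 * L -> 0 < c y.
Proof.
intros Hy. eapply Rlt_le_trans; [|apply (rs_clow _ _ _ _ _ _ Hs); lra].
apply Rmult_lt_0_compat; [easy | apply (rs_wpos _ _ _ _ _ _ Hs); lra].
Qed.

Lemma slope_ge0 y : 0 <= slope y.
Proof. apply Rmult_le_pos; apply pw_ge0. Qed.

Lemma dw_slope y : 0 < y < 2 * L -> is_derive w y (- (pw (c y) th * slope y)).
Proof.
intros Hy. evar_last; [now apply (rs_dw _ _ _ _ _ _ Hs)|].
f_equal. pose proof (U_ge0 y ltac:(lra)).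
rewrite pw_mult, pw_mult, !pw_pw; try easy; try apply pw_ge0; [|apply Rmult_le_pos; apply pw_ge0].
unfold slope. rewrite Hth. ring.
Qed.

Lemma slope_upper y : 0 < y <= 2 * L -> slope y <= pw (/ (B + 1)) e * pw y ((B + 1 - A) * e).
Proof.
intros Hy. unfold slope.
apply Rle_trans with (pw y (- A * e) * pw (pw y (B + 1) / (B + 1)) e).
- apply Rmult_le_compat_l; [apply pw_ge0|]. apply pw_le; [apply Rlt_le, e_pos|]. apply U_upper; lra.
- right. unfold Rdiv. rewrite pw_mult, pw_pw by (try apply pw_ge0; apply Rlt_le, Rinv_0_lt_compat; lra).
  replace ((B + 1 - A) * e) with (- A * e + (B + 1) * e) by ring. rewrite pw_plus. ring.
Qed.

Lemma w_half y : 0 <= y <= y_half -> 1 / 2 <= w y.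
Proof.
intros Hy. pose proof y_half_bounds. pose proof w_lip_pos. pose proof w_lip_y_half.
assert (H2 := nondecreasing_of_derive (fun t => w t + w_lip * t)
  (fun t => - (pw (c t) th * slope t) + w_lip * 1) 0 y ltac:(lra)). cbv beta in H2.
rewrite (rs_w0 _ _ _ _ _ _ Hs) in H2.
assert (1 + w_lip * 0 <= w y + w_lip * y).
{ apply H2; clear H2.
- intros x Hx. apply continuous_Rplus; [apply (rs_wc _ _ _ _ _ _ Hs); lra|].
  apply continuous_Rscal, continuous_id.
- intros x Hx. apply is_derive_Rplus; [apply dw_slope; lra|].
  apply is_derive_Rscal, is_derive_Rid.
- intros x Hx.
  assert (pw (c x) th * slope x <= pw C4 th * (pw (/ (B + 1)) e * 1)).
  { pose proof th_bounds. apply Rmult_le_compat; [apply pw_ge0 | apply slope_ge0 | |].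
    - apply pw_le; [lra|]. apply (rs_chigh _ _ _ _ _ _ Hs); lra.
    - eapply Rle_trans; [apply slope_upper; lra|]. apply Rmult_le_compat_l; [apply pw_ge0|].
      apply pw_le1; [|lra].
      apply Rmult_le_pos; [lra | apply Rlt_le, e_pos]. }
  unfold w_lip. lra. }
assert (w_lip * y <= w_lip * y_half) by (apply Rmult_le_compat_l; lra). lra.
Qed.

Lemma U_floor_le : U_floor <= U y_half.
Proof.
pose proof y_half_bounds. apply U_lower; try lra. intros x Hx. now apply w_half.
Qed.

(** The factor [(c / w)^th] measures the deviation from the limit equation: the slope of
    [w^(1-th) / (1-th)] is this factor times [slope], up to sign. The lower bound holds everywhere,
    whereas [rs_near] gives closeness to 1 only where [w >= eta]. *)
Lemma rho_low y : 0 < y < 2 * L -> pw c3 th <= pw (c y / w y) th.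
Proof.
intros Hy. pose proof (rs_wpos _ _ _ _ _ _ Hs y ltac:(lra)).
apply pw_le; [apply Rlt_le, th_bounds|].
apply (Rmult_le_reg_r (w y)); [easy|].
unfold Rdiv. rewrite Rmult_assoc, Rinv_l, Rmult_1_r by lra. now apply (rs_clow _ _ _ _ _ _ Hs).
Qed.

Lemma rho_eq y : 0 < y < 2 * L -> pw (c y / w y) th = pw (c y) th * pw (w y) (- th).
Proof.
intros Hy. pose proof (rs_wpos _ _ _ _ _ _ Hs y ltac:(lra)). pose proof (c_pos y Hy).
unfold Rdiv. rewrite pw_mult, pw_inv_l; try lra. apply Rlt_le, Rinv_0_lt_compat; lra.
Qed.

(* On [y, 2L] the slope of w^(1-th) is at least its value with U frozen at y, and w is still positive at 2L. *)
Lemma w_drop y : 0 < y <= L ->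
  drop_rate * L * (pw (2 * L) (- A * e) * pw (U y) e) <= pw (w y) (1 - th).
Proof.
intros Hy. pose proof th_bounds. pose proof e_pos.
set (k := drop_rate * (pw (2 * L) (- A * e) * pw (U y) e)).
assert (Hk : 0 <= k).
{ apply Rmult_le_pos; [apply Rlt_le, drop_rate_pos|]. apply Rmult_le_pos; apply pw_ge0. }
assert (H2 := nondecreasing_of_derive (fun t => - k * t - pw (w t) (1 - th))
  (fun t => - k * 1 - (1 - th) * pw (w t) (1 - th - 1) * (- (pw (c t) th * slope t))) y (2 * L) ltac:(lra)).
cbv beta in H2.
assert (- k * y - pw (w y) (1 - th) <= - k * (2 * L) - pw (w (2 * L)) (1 - th)).
{ apply H2; clear H2.
- intros x Hx. apply continuous_Rminus; [apply continuous_Rscal, continuous_id|].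
  apply continuous_pw_comp; [lra | apply (rs_wc _ _ _ _ _ _ Hs); lra].
- intros x Hx. apply is_derive_Rminus; [apply is_derive_Rscal, is_derive_Rid|].
  apply is_derive_pw_comp; [apply (rs_wpos _ _ _ _ _ _ Hs); lra | apply dw_slope; lra].
- intros x Hx. replace (1 - th - 1) with (- th) by ring.
  replace (- k * 1 - (1 - th) * pw (w x) (- th) * - (pw (c x) th * slope x))
    with ((1 - th) * ((pw (c x) th * pw (w x) (- th)) * slope x) - k) by ring.
  rewrite <- rho_eq by lra.
  assert (pw (2 * L) (- A * e) * pw (U y) e <= slope x).
  { unfold slope. apply Rmult_le_compat; try apply pw_ge0.
    - replace (- A * e) with (- (A * e)) by ring. rewrite !pw_opp by lra.
      apply Rinv_le_contravar; [apply pw_pos; lra|].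
      apply pw_le; [|lra]. apply Rmult_le_pos; lra.
    - apply pw_le; [lra|]. apply U_le; lra. }
  pose proof (rho_low x ltac:(lra)). pose proof (pw_ge0 c3 th).
  assert (pw c3 th * (pw (2 * L) (- A * e) * pw (U y) e) <= pw (c x / w x) th * slope x).
  { apply Rmult_le_compat; try lra. apply Rmult_le_pos; apply pw_ge0. }
  unfold k, drop_rate.
  assert ((1 - th) * (pw c3 th * (pw (2 * L) (- A * e) * pw (U y) e)) <= (1 - th) * (pw (c x / w x) th * slope x)).
  { apply Rmult_le_compat_l; lra. }
  lra. }
pose proof (pw_ge0 (w (2 * L)) (1 - th)).
replace (drop_rate * L * (pw (2 * L) (- A * e) * pw (U y) e)) with (k * L) by (unfold k; ring).
assert (k * y <= k * L) by (apply Rmult_le_compat_l; lra). lra.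
Qed.

(** This level depends on [L] but not on the solution, so it can serve as [eta], which makes
    [rs_near] available on all of [(0, L)]. From [y_half] on, it is [w_drop] with [U >= U_floor];
    before [y_half], [w] is larger by monotonicity. *)
Lemma w_lower y : 0 <= y <= L ->
  pw (drop_rate * L * (pw (2 * L) (- A * e) * pw U_floor e)) (/ (1 - th)) <= w y.
Proof.
pose proof th_bounds. pose proof y_half_bounds. pose proof e_pos.
assert (Hl : forall y, y_half <= y <= L ->
  pw (drop_rate * L * (pw (2 * L) (- A * e) * pw U_floor e)) (/ (1 - th)) <= w y).
{ intros z Hz. pose proof (rs_wpos _ _ _ _ _ _ Hs z ltac:(lra)).
  replace (w z) with (pw (pw (w z) (1 - th)) (/ (1 - th))) by (rewrite pw_pw, Rinv_r, pw_x1; lra). 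
  apply pw_le; [apply Rlt_le, Rinv_0_lt_compat; lra|].
  eapply Rle_trans; [|apply w_drop; lra].
  apply Rmult_le_compat_l; [apply Rmult_le_pos; [apply Rlt_le, drop_rate_pos | lra]|].
  apply Rmult_le_compat_l; [apply pw_ge0|].
  apply pw_le; [lra|]. eapply Rle_trans; [apply U_floor_le|]. apply U_le; lra. }
intros Hy. destruct (Rle_lt_dec y_half y); [apply Hl; lra|].
apply Rle_trans with (w y_half); [apply Hl; lra | apply w_le; lra].
Qed.

(** As [w] decreases, [U y >= w(y)^p y^(B+1) / (B+1)]. Inserted into the equation for [w'], this
    gives [(w^(-tau_exp))' >= tau_exp k y^(nu_exp - 1)], and integration over [[0, L]] yields decay
    at the scaling rate. *)
Lemma w_decay : w L <= pw (tau_exp * (pw c3 th * pw (/ (B + 1)) e) / nu_exp) (- / tau_exp) * pw L (- (nu_exp / tau_exp)).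
Proof.
pose proof th_bounds. pose proof e_pos. pose proof tau_exp_pos. pose proof nu_exp_gt1.
pose proof (rs_wpos _ _ _ _ _ _ Hs L ltac:(lra)) as HwL.
set (k := pw c3 th * pw (/ (B + 1)) e).
assert (Hk : 0 < k).
{ apply Rmult_lt_0_compat; apply pw_pos; [easy|]. apply Rinv_0_lt_compat; lra. }
assert (H3 := nondecreasing_of_derive (fun t => pw (w t) (- tau_exp) - tau_exp * k / nu_exp * pw t nu_exp)
  (fun t => (- tau_exp) * pw (w t) (- tau_exp - 1) * (- (pw (c t) th * slope t)) - tau_exp * k / nu_exp * (nu_exp * pw t (nu_exp - 1))) 0 L ltac:(lra)).
cbv beta in H3. rewrite (rs_w0 _ _ _ _ _ _ Hs), pw_1, (pw_npos 0) in H3 by lra.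
assert (H4 : 1 - tau_exp * k / nu_exp * 0 <= pw (w L) (- tau_exp) - tau_exp * k / nu_exp * pw L nu_exp).
{ apply H3; clear H3.
- intros x Hx. apply continuous_Rminus.
  + apply continuous_pw_comp_pos; [apply (rs_wpos _ _ _ _ _ _ Hs); lra | apply (rs_wc _ _ _ _ _ _ Hs); lra].
  + apply continuous_Rscal, continuous_pw; lra.
- intros x Hx. apply is_derive_Rminus.
  + apply is_derive_pw_comp; [apply (rs_wpos _ _ _ _ _ _ Hs); lra | apply dw_slope; lra].
  + apply is_derive_Rscal, is_derive_pw; lra.
- intros x Hx. pose proof (rs_wpos _ _ _ _ _ _ Hs x ltac:(lra)) as Hw.
  replace (- tau_exp * pw (w x) (- tau_exp - 1) * - (pw (c x) th * slope x) - tau_exp * k / nu_exp * (nu_exp * pw x (nu_exp - 1)))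
    with (tau_exp * (pw (w x) (- tau_exp - 1) * pw (c x) th * slope x - k * pw x (nu_exp - 1))) by (field; lra).
  apply Rmult_le_pos; [lra|].
  replace (- tau_exp - 1) with (- th + - (p * e)) by (unfold tau_exp; ring). rewrite pw_plus.
  replace (pw (w x) (- th) * pw (w x) (- (p * e)) * pw (c x) th * slope x)
    with ((pw (c x) th * pw (w x) (- th)) * (pw (w x) (- (p * e)) * slope x)) by ring.
  rewrite <- rho_eq by lra.
  assert (HS : pw (/ (B + 1)) e * pw x (nu_exp - 1) <= pw (w x) (- (p * e)) * slope x).
  { unfold slope.
    assert (HU : pw (w x) (p * e) * (pw x ((B + 1) * e) * pw (/ (B + 1)) e) <= pw (U x) e).
    { assert (Hi : 0 <= / (B + 1)) by (apply Rlt_le, Rinv_0_lt_compat; lra).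
      rewrite <- !pw_pw, <- !pw_mult; try apply pw_ge0; try easy;
        [|apply Rmult_le_pos; [apply pw_ge0 | easy]].
      apply pw_le; [lra|]. apply U_lower; try lra. intros t Ht. apply w_le; lra. }
    replace (nu_exp - 1) with (- A * e + (B + 1) * e) by (unfold nu_exp; ring). rewrite pw_plus.
    rewrite pw_opp by lra. assert (Hwp : 0 < pw (w x) (p * e)) by (now apply pw_pos).
    apply (Rmult_le_reg_l (pw (w x) (p * e))); [easy|].
    replace (pw (w x) (p * e) * (/ pw (w x) (p * e) * (pw x (- A * e) * pw (U x) e)))
      with (pw x (- A * e) * pw (U x) e) by (field; lra).
    replace (pw (w x) (p * e) * (pw (/ (B + 1)) e * (pw x (- A * e) * pw x ((B + 1) * e))))
      with (pw x (- A * e) * (pw (w x) (p * e) * (pw x ((B + 1) * e) * pw (/ (B + 1)) e))) by ring.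
    apply Rmult_le_compat_l; [apply pw_ge0 | exact HU]. }
  pose proof (rho_low x ltac:(lra)). pose proof (pw_ge0 c3 th).
  assert (pw c3 th * (pw (/ (B + 1)) e * pw x (nu_exp - 1)) <= pw (c x / w x) th * (pw (w x) (- (p * e)) * slope x)).
  { apply Rmult_le_compat; try lra. apply Rmult_le_pos; apply pw_ge0. }
  unfold k. lra. }
assert (Hq : 0 < tau_exp * k / nu_exp) by (apply Rdiv_lt_0_compat; [apply Rmult_lt_0_compat; lra | lra]).
assert (HLn : 0 < pw L nu_exp) by (apply pw_pos; lra).
assert (H5 : tau_exp * k / nu_exp * pw L nu_exp <= pw (w L) (- tau_exp)) by lra.
assert (H6 : pw (pw (w L) (- tau_exp)) (- / tau_exp) = w L).
{ rewrite pw_pw. replace (- tau_exp * - / tau_exp) with 1 by (field; lra). apply pw_x1; lra. }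
rewrite <- H6.
apply Rle_trans with (pw (tau_exp * k / nu_exp * pw L nu_exp) (- / tau_exp)).
- rewrite (pw_opp (tau_exp * k / nu_exp * pw L nu_exp)), (pw_opp (pw (w L) (- tau_exp)));
    [|now apply pw_pos | apply Rmult_lt_0_compat; lra].
  apply Rinv_le_contravar; [apply pw_pos, Rmult_lt_0_compat; lra|].
  apply pw_le; [apply Rlt_le, Rinv_0_lt_compat; lra | easy].
- right. rewrite pw_mult, pw_pw by lra. f_equal. f_equal. field; lra.
Qed.


(** * The Pohozaev identity and its lower bound *)

Definition poh_coef := (A + 1 - m) / m.

(* Constant multiples aside, y^(A+1) |z'|^m + y^(B+1) z^(q+1) - U z for z = w^(1-th), in terms of (w, U). *)
Definition pohozaev y := / (1 + e) * (pw y (1 - A * e) * pw (U y) (1 + e))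
  + / (p + 1 - th) * (pw y (B + 1) * pw (w y) (p + 1 - th))
  - poh_coef / (1 - th) * (U y * pw (w y) (1 - th)).

Lemma e_eq : e = / (m - 1).
Proof. apply (Rmult_eq_reg_r (m - 1)); [|lra]. rewrite He. field; lra. Qed.

(** The value of [poh_coef] is the one for which the terms in [U * slope] cancel when [c = w]. The
    terms in [y * slope * U'] cancel in that case as well, so the source term remains, with an error
    proportional to [1 - (c / w)^th]. *)
Lemma is_derive_pohozaev y : 0 < y < 2 * L ->
  is_derive pohozaev y (poh_gap * (pw y B * pw (w y) p * pw (w y) (1 - th))
    + (1 - pw (c y / w y) th) * (y * slope y * (pw y B * pw (w y) p) - poh_coef * U y * slope y)).
Proof.
intros Hy. pose proof th_bounds. pose proof e_pos.
pose proof (rs_wpos _ _ _ _ _ _ Hs y ltac:(lra)) as Hw.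
pose proof (U_pos y ltac:(lra)) as HU.
pose proof (rs_dU _ _ _ _ _ _ Hs y Hy) as HdU.
pose proof (dw_slope y Hy) as Hdw.
evar_last.
- apply is_derive_Rminus; [apply is_derive_Rplus|].
  + apply is_derive_Rscal, is_derive_Rmult; [apply is_derive_pw; lra|].
    apply is_derive_pw_comp; [exact HU | exact HdU].
  + apply is_derive_Rscal, is_derive_Rmult; [apply is_derive_pw; lra|].
    apply is_derive_pw_comp; [exact Hw | exact Hdw].
  + apply is_derive_Rscal, is_derive_Rmult; [exact HdU|].
    apply is_derive_pw_comp; [exact Hw | exact Hdw].
- rewrite rho_eq by lra. unfold slope, poh_gap, poh_coef.
  replace (1 - A * e - 1) with (- A * e) by ring.
  replace (1 - A * e) with (- A * e + 1) at 2 by ring.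
  rewrite (pw_plus1 y (- A * e)) by lra.
  replace (1 + e - 1) with e by ring.
  replace (pw (U y) (1 + e)) with (pw (U y) e * U y) by (rewrite (Rplus_comm 1 e), pw_plus1; lra).
  replace (B + 1 - 1) with B by ring. rewrite (pw_plus1 y B) by lra.
  replace (pw (w y) (p + 1 - th)) with (pw (w y) p * pw (w y) (1 - th))
    by (rewrite <- pw_plus; f_equal; ring).
  replace (pw (w y) (p + 1 - th - 1)) with (pw (w y) p * pw (w y) (- th))
    by (rewrite <- pw_plus; f_equal; ring).
  replace (1 - th - 1) with (- th) by ring.
  generalize (pw y (- A * e)) (pw (U y) e) (pw y B) (pw (w y) p) (pw (w y) (1 - th)) (pw (w y) (- th)) (pw (c y) th).
  intros Y V Yb Wp X T C.
  assert (H1e : 1 - A * e = - (A + 1 - m) / (m - 1)) by (rewrite e_eq; field; lra).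
  assert (H2e : 1 + e = m / (m - 1)) by (rewrite e_eq; field; lra).
  rewrite H1e, H2e. field. repeat split; lra.
Qed.

Definition poh_err := pw (/ (B + 1)) e * pw L ((B + 1 - A) * e) * (pw L (B + 1) + poh_coef * (pw L (B + 1) / (B + 1))).

Lemma poh_coef_pos : 0 < poh_coef.
Proof. apply Rdiv_lt_0_compat; lra. Qed.

(** The bound follows from [w <= 1] and the upper bounds on [U] and [slope]. It grows with [L] but
    is the same for all solutions, which allows [eps] to be chosen after [L]. *)
Lemma poh_err_bound y : 0 < y < L -> Rabs (y * slope y * (pw y B * pw (w y) p) - poh_coef * U y * slope y) <= poh_err.
Proof.
intros Hy. pose proof e_pos. pose proof poh_coef_pos.
pose proof (rs_wpos _ _ _ _ _ _ Hs y ltac:(lra)) as Hw.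
pose proof (w_le1 y ltac:(lra)) as Hw1. pose proof (U_ge0 y ltac:(lra)) as HU0.
assert (HyL : pw y (B + 1) <= pw L (B + 1)) by (apply pw_le; lra).
assert (HUL : U y <= pw L (B + 1) / (B + 1)).
{ eapply Rle_trans; [apply U_upper; lra|]. apply Rmult_le_compat_r; [apply Rlt_le, Rinv_0_lt_compat; lra | easy]. }
assert (HSL : slope y <= pw (/ (B + 1)) e * pw L ((B + 1 - A) * e)).
{ eapply Rle_trans; [apply slope_upper; lra|]. apply Rmult_le_compat_l; [apply pw_ge0|].
  apply pw_le; [apply Rmult_le_pos; lra | lra]. }
assert (Hwp : pw (w y) p <= 1) by (apply pw_le1; lra).
replace (y * slope y * (pw y B * pw (w y) p) - poh_coef * U y * slope y)
  with (slope y * (pw y B * y * pw (w y) p - poh_coef * U y)) by ring.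
rewrite <- pw_plus1 by lra.
pose proof (slope_ge0 y). rewrite Rabs_mult, (Rabs_pos_eq (slope y)) by easy.
apply Rmult_le_compat; [easy | apply Rabs_pos | easy |].
assert (0 <= pw y (B + 1) * pw (w y) p) by (apply Rmult_le_pos; apply pw_ge0).
assert (pw y (B + 1) * pw (w y) p <= pw L (B + 1) * 1)
  by (apply Rmult_le_compat; try apply pw_ge0; easy).
assert (0 <= poh_coef * U y) by (apply Rmult_le_pos; lra).
assert (poh_coef * U y <= poh_coef * (pw L (B + 1) / (B + 1))) by (apply Rmult_le_compat_l; lra).
apply Rabs_le. lra.
Qed.

Definition w_floor := pw (drop_rate * L * (pw (2 * L) (- A * e) * pw U_floor e)) (/ (1 - th)).

Lemma continuous_pohozaev y : 0 < y < 2 * L -> continuous pohozaev y.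
Proof. intros Hy. eapply is_derive_continuous, is_derive_pohozaev, Hy. Qed.

(* The identity is integrated from s > 0 and s is sent to 0, since individual terms may be singular at 0. *)
Lemma pohozaev_lower : eta <= w_floor -> poh_floor - eps * poh_err * L <= pohozaev L.
Proof.
intros Heta. pose proof th_bounds. pose proof y_half_bounds. pose proof e_pos.
pose proof poh_gap_pos. pose proof poh_coef_pos.
assert (HE : forall y, 0 < y < L ->
  - (eps * poh_err) <= (1 - pw (c y / w y) th) * (y * slope y * (pw y B * pw (w y) p) - poh_coef * U y * slope y)).
{ intros y Hy.
  assert (Hn : Rabs (pw (c y / w y) th - 1) <= eps).
  { apply (rs_near _ _ _ _ _ _ Hs); [easy|]. eapply Rle_trans; [exact Heta|]. apply w_lower; lra. }
  pose proof (poh_err_bound y Hy) as Hb.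
  rewrite Rabs_minus_sym in Hn.
  assert (Hm' : Rabs ((1 - pw (c y / w y) th) * (y * slope y * (pw y B * pw (w y) p) - poh_coef * U y * slope y)) <= eps * poh_err).
  { rewrite Rabs_mult. apply Rmult_le_compat; try apply Rabs_pos; easy. }
  apply Rabs_le_between in Hm'. lra. }
(* The linear term absorbs the error, whose sign is unknown, and makes the sum nondecreasing. *)
assert (Hstep1 : pohozaev y_half + eps * poh_err * y_half <= pohozaev L + eps * poh_err * L).
{ apply (nondecreasing_of_derive (fun t => pohozaev t + eps * poh_err * t)
    (fun y => poh_gap * (pw y B * pw (w y) p * pw (w y) (1 - th))
      + (1 - pw (c y / w y) th) * (y * slope y * (pw y B * pw (w y) p) - poh_coef * U y * slope y) + eps * poh_err * 1)).
  - lra.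
  - intros x Hx. apply continuous_Rplus; [apply continuous_pohozaev; lra | apply continuous_Rscal, continuous_id].
  - intros x Hx. apply is_derive_Rplus; [apply is_derive_pohozaev; lra | apply is_derive_Rscal, is_derive_Rid].
  - intros x Hx. pose proof (HE x ltac:(lra)).
    assert (0 <= poh_gap * (pw x B * pw (w x) p * pw (w x) (1 - th)))
      by (repeat apply Rmult_le_pos; try apply pw_ge0; lra).
    lra. }
set (k := poh_gap * pw (1 / 2) (1 - th)).
assert (Hk : 0 < k) by (apply Rmult_lt_0_compat; [easy | apply pw_pos; lra]).
(* Up to [y_half], where [w >= 1/2], the source term dominates [k * U']; this gain [k * U y_half] is
   the origin of [poh_floor]. *)
assert (Hstep2 : forall s, 0 < s <= y_half ->
  pohozaev s + eps * poh_err * s - k * U s <= pohozaev y_half + eps * poh_err * y_half - k * U y_half).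
{ intros s Hss. apply (nondecreasing_of_derive (fun t => pohozaev t + eps * poh_err * t - k * U t)
    (fun y => poh_gap * (pw y B * pw (w y) p * pw (w y) (1 - th))
      + (1 - pw (c y / w y) th) * (y * slope y * (pw y B * pw (w y) p) - poh_coef * U y * slope y) + eps * poh_err * 1
      - k * (pw y B * pw (w y) p))).
  - lra.
  - intros x Hx. apply continuous_Rminus; [apply continuous_Rplus|].
    + apply continuous_pohozaev; lra.
    + apply continuous_Rscal, continuous_id.
    + apply continuous_Rscal, (rs_Uc _ _ _ _ _ _ Hs); lra.
  - intros x Hx. apply is_derive_Rminus; [apply is_derive_Rplus|].
    + apply is_derive_pohozaev; lra.
    + apply is_derive_Rscal, is_derive_Rid.
    + apply is_derive_Rscal, (rs_dU _ _ _ _ _ _ Hs); lra.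
  - intros x Hx. pose proof (HE x ltac:(lra)).
    assert (0 <= (poh_gap * (pw x B * pw (w x) p)) * (pw (w x) (1 - th) - pw (1 / 2) (1 - th))).
    { apply Rmult_le_pos; [repeat apply Rmult_le_pos; try apply pw_ge0; lra|].
      assert (pw (1 / 2) (1 - th) <= pw (w x) (1 - th)); [|lra].
      apply pw_le; [lra|]. apply w_half; lra. }
    unfold k. lra. }
assert (Hlow : forall s, 0 < s <= L -> - (poh_coef / (1 - th)) * U s <= pohozaev s).
{ intros s Hss. unfold pohozaev.
  assert (0 <= / (1 + e) * (pw s (1 - A * e) * pw (U s) (1 + e))).
  { apply Rmult_le_pos; [apply Rlt_le, Rinv_0_lt_compat; lra|]. apply Rmult_le_pos; apply pw_ge0. }
  assert (0 <= / (p + 1 - th) * (pw s (B + 1) * pw (w s) (p + 1 - th))).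
  { apply Rmult_le_pos; [apply Rlt_le, Rinv_0_lt_compat; lra|]. apply Rmult_le_pos; apply pw_ge0. }
  assert (Hq : 0 < poh_coef / (1 - th)) by (apply Rdiv_lt_0_compat; lra).
  assert (HX : pw (w s) (1 - th) <= 1).
  { apply pw_le1; [lra|]. apply w_le1; lra. }
  pose proof (U_ge0 s ltac:(lra)).
  assert (poh_coef / (1 - th) * (U s * pw (w s) (1 - th)) <= poh_coef / (1 - th) * (U s * 1)).
  { apply Rmult_le_compat_l; [lra|]. apply Rmult_le_compat_l; lra. }
  lra. }
assert (Hcs : poh_floor <= k * U y_half).
{ unfold poh_floor, k. apply Rmult_le_compat_l; [apply Rmult_le_pos; [lra | apply pw_ge0] | apply U_floor_le]. }
apply Rle_plus_epsilon. intros d Hd.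
(* The sign of [eps] is read off from [rs_near] at the interior point [L / 2]. *)
assert (He0 : 0 <= eps * poh_err).
{ apply Rmult_le_pos.
  - eapply Rle_trans; [apply Rabs_pos|]. apply (rs_near _ _ _ _ _ _ Hs (L / 2)); [lra|].
    eapply Rle_trans; [exact Heta|]. apply w_lower; lra.
  - eapply Rle_trans; [apply Rabs_pos | apply (poh_err_bound (L / 2)); lra]. }
set (M := poh_coef / (1 - th) + k).
assert (HM : 0 < M) by (unfold M; assert (0 < poh_coef / (1 - th)) by (apply Rdiv_lt_0_compat; lra); lra).
set (d' := d / M).
assert (Hd' : 0 < d') by (now apply Rdiv_lt_0_compat).
(* Small enough for [U_upper] to give [U s <= d'], hence [M * U s <= d]. *)
set (s := Rmin y_half (pw (d' * (B + 1)) (/ (B + 1)))).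
assert (Hs0 : 0 < s <= y_half).
{ split; [|apply Rmin_l]. apply Rmin_glb_lt; [lra|]. apply pw_pos, Rmult_lt_0_compat; lra. }
assert (HUs : U s <= d').
{ eapply Rle_trans; [apply U_upper; lra|].
  apply (Rmult_le_reg_r (B + 1)); [lra|]. unfold Rdiv at 1. rewrite Rmult_assoc, Rinv_l, Rmult_1_r by lra.
  apply Rle_trans with (pw (pw (d' * (B + 1)) (/ (B + 1))) (B + 1)).
  - apply pw_le; [lra | apply Rmin_r].
  - rewrite pw_pw, Rinv_l, pw_x1; [lra | | lra]. apply Rmult_le_pos; lra. }
pose proof (Hlow s ltac:(lra)). pose proof (Hstep2 s Hs0).
assert (HMd : M * U s <= d).
{ replace d with (M * d') by (unfold d'; field; lra). apply Rmult_le_compat_l; lra. }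
assert (0 <= eps * poh_err * s) by (apply Rmult_le_pos; lra).
unfold M in HMd. lra.
Qed.

(** * Decay of the Pohozaev functional at the right end *)

Definition flux_coef := pw 2 (A * e) / drop_rate.
Definition decay_coef := pw (tau_exp * (pw c3 th * pw (/ (B + 1)) e) / nu_exp) (- / tau_exp).
(** [flux_gap] and [source_gap] are the decay exponents in [L] of the first two terms of
    [pohozaev L] when [w L] decays at the scaling rate. *)
Definition flux_gap := (1 - th) * m * (nu_exp / tau_exp) - (A + 1 - m).
Definition source_gap := (p + 1 - th) * (nu_exp / tau_exp) - (B + 1).
Definition flux_const := / (1 + e) * (pw flux_coef m * pw decay_coef ((1 - th) * m)).
Definition source_const := / (p + 1 - th) * pw decay_coef (p + 1 - th).

Lemma flux_coef_pos : 0 < flux_coef.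
Proof. apply Rdiv_lt_0_compat; [apply pw_pos; lra | apply drop_rate_pos]. Qed.

Lemma decay_coef_pos : 0 < decay_coef.
Proof.
pose proof tau_exp_pos. pose proof nu_exp_gt1.
apply pw_pos, Rdiv_lt_0_compat; [|lra]. apply Rmult_lt_0_compat; [lra|].
apply Rmult_lt_0_compat; apply pw_pos; [easy|]. apply Rinv_0_lt_compat; lra.
Qed.

(** Multiplied by [tau_exp * (m - 1)], both [flux_gap] and [source_gap] equal
    [m (1-th) (B+1) - (p+1-th) (A+1-m)]. Subcriticality thus says precisely that decay at the
    scaling rate is fast enough. *)
Lemma flux_gap_pos : 0 < flux_gap.
Proof.
pose proof tau_exp_pos as Ht. pose proof e_pos. pose proof th_bounds.
unfold flux_gap. apply (Rmult_lt_reg_r (tau_exp * (m - 1))); [apply Rmult_lt_0_compat; lra|].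
rewrite Rmult_0_l.
replace (((1 - th) * m * (nu_exp / tau_exp) - (A + 1 - m)) * (tau_exp * (m - 1)))
  with ((1 - th) * m * (nu_exp * (m - 1)) - (A + 1 - m) * (tau_exp * (m - 1))) by (field; lra).
unfold nu_exp, tau_exp.
replace ((((B + 1 - A) * e) + 1) * (m - 1)) with ((B + 1 - A) * (e * (m - 1)) + (m - 1)) by ring.
replace ((th + p * e - 1) * (m - 1)) with (p * (e * (m - 1)) - (m - 1) * (1 - th)) by ring.
rewrite He. nra.
Qed.

Lemma source_gap_pos : 0 < source_gap.
Proof.
pose proof tau_exp_pos as Ht. pose proof e_pos. pose proof th_bounds.
unfold source_gap. apply (Rmult_lt_reg_r (tau_exp * (m - 1))); [apply Rmult_lt_0_compat; lra|].
rewrite Rmult_0_l.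
replace (((p + 1 - th) * (nu_exp / tau_exp) - (B + 1)) * (tau_exp * (m - 1)))
  with ((p + 1 - th) * (nu_exp * (m - 1)) - (B + 1) * (tau_exp * (m - 1))) by (field; lra).
unfold nu_exp, tau_exp.
replace ((((B + 1 - A) * e) + 1) * (m - 1)) with ((B + 1 - A) * (e * (m - 1)) + (m - 1)) by ring.
replace ((th + p * e - 1) * (m - 1)) with (p * (e * (m - 1)) - (m - 1) * (1 - th)) by ring.
rewrite He. nra.
Qed.

(** [w_drop] at [L] bounds [U L] by a power of [w L], and [w_decay] bounds [w L]; the third term of
    [pohozaev] is nonpositive and is dropped. *)
Lemma pohozaev_upper : pohozaev L <= flux_const * pw L (- flux_gap) + source_const * pw L (- source_gap).
Proof.
pose proof th_bounds. pose proof e_pos. pose proof poh_coef_pos. pose proof drop_rate_pos. pose proof flux_coef_pos.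
pose proof decay_coef_pos. pose proof tau_exp_pos.
pose proof (rs_wpos _ _ _ _ _ _ Hs L ltac:(lra)) as Hw.
pose proof (U_pos L ltac:(lra)) as HU.
pose proof w_decay as Hd. fold decay_coef in Hd.
assert (HUe : pw (U L) e <= flux_coef * pw L (A * e - 1) * pw (w L) (1 - th)).
{ pose proof (w_drop L ltac:(lra)) as Hdr.
  assert (Hp0 : 0 < drop_rate * L * pw (2 * L) (- A * e)).
  { apply Rmult_lt_0_compat; [apply Rmult_lt_0_compat; lra | apply pw_pos; lra]. }
  apply (Rmult_le_reg_l _ _ _ Hp0).
  replace (drop_rate * L * pw (2 * L) (- A * e) * pw (U L) e) with (drop_rate * L * (pw (2 * L) (- A * e) * pw (U L) e)) by ring.
  eapply Rle_trans; [exact Hdr|]. right. unfold flux_coef.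
  replace (- A * e) with (- (A * e)) by ring.
  replace (A * e - 1) with (A * e + Ropp 1) by ring.
  rewrite pw_opp, pw_plus, (pw_opp L 1), pw_x1, pw_mult by lra.
  assert (0 < pw L (A * e)) by (apply pw_pos; lra). assert (0 < pw 2 (A * e)) by (apply pw_pos; lra).
  field. repeat split; lra. }
assert (Hfirst : pw L (1 - A * e) * pw (U L) (1 + e) <= pw flux_coef m * pw decay_coef ((1 - th) * m) * pw L (- flux_gap)).
{ replace (1 + e) with (e * m) by (rewrite <- He; ring).
  rewrite <- pw_pw.
  apply Rle_trans with (pw L (1 - A * e) * pw (flux_coef * pw L (A * e - 1) * pw (decay_coef * pw L (- (nu_exp / tau_exp))) (1 - th)) m).
  - apply Rmult_le_compat_l; [apply pw_ge0|]. apply pw_le; [lra|].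
    eapply Rle_trans; [exact HUe|]. apply Rmult_le_compat_l.
    + apply Rmult_le_pos; [lra | apply pw_ge0].
    + apply pw_le; [lra | exact Hd].
  - right. rewrite (pw_mult decay_coef), (pw_mult (flux_coef * _)), (pw_mult flux_coef), (pw_mult (pw decay_coef _)), !pw_pw;
      try apply pw_ge0; try lra; try (apply Rmult_le_pos; try apply pw_ge0; lra).
    replace (- flux_gap) with ((1 - A * e) + ((A * e - 1) * m + - (nu_exp / tau_exp) * ((1 - th) * m))).
    + rewrite (pw_plus L (1 - A * e)), (pw_plus L ((A * e - 1) * m)), Rmult_assoc. ring.
    + unfold flux_gap. assert (Hae : A * e - 1 = (A - (m - 1)) * e) by (rewrite Rmult_minus_distr_r, (Rmult_comm (m - 1)), He; ring).
      replace (1 - A * e) with (- (A * e - 1)) by ring. rewrite Hae.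
      replace (- ((A - (m - 1)) * e) + ((A - (m - 1)) * e * m + - (nu_exp / tau_exp) * ((1 - th) * m)))
        with ((A - (m - 1)) * (e * (m - 1)) + - (nu_exp / tau_exp) * ((1 - th) * m)) by ring.
      rewrite He. ring. }
assert (Hsecond : pw L (B + 1) * pw (w L) (p + 1 - th) <= pw decay_coef (p + 1 - th) * pw L (- source_gap)).
{ apply Rle_trans with (pw L (B + 1) * pw (decay_coef * pw L (- (nu_exp / tau_exp))) (p + 1 - th)).
  - apply Rmult_le_compat_l; [apply pw_ge0|]. apply pw_le; [lra | exact Hd].
  - right. rewrite pw_mult, pw_pw by (try apply pw_ge0; lra).
    replace (- source_gap) with ((B + 1) + - (nu_exp / tau_exp) * (p + 1 - th)) by (unfold source_gap; ring).
    rewrite (pw_plus L (B + 1)). ring. }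
unfold pohozaev, flux_const, source_const.
assert (0 <= poh_coef / (1 - th) * (U L * pw (w L) (1 - th))).
{ apply Rmult_le_pos; [apply Rlt_le, Rdiv_lt_0_compat; lra|]. apply Rmult_le_pos; [lra | apply pw_ge0]. }
apply (Rmult_le_compat_l (/ (1 + e))) in Hfirst; [|apply Rlt_le, Rinv_0_lt_compat; lra].
apply (Rmult_le_compat_l (/ (p + 1 - th))) in Hsecond; [|apply Rlt_le, Rinv_0_lt_compat; lra].
lra.
Qed.

End Fixed_solution.

(** First [L] is taken so large that [pohozaev L <= poh_floor / 2]. Then [eta] is the lower bound of
    [w] on [[0, L]], and [eps] keeps the error accumulated over [[0, L]] at [poh_floor / 4], which
    contradicts [pohozaev_lower]. *)
Theorem no_rescaled_solution : exists L eta eps, 1 <= L /\ 0 < eta /\ 0 < eps /\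
  forall w U c, ~ rescaled_solution L eta eps w U c.
Proof.
pose proof th_bounds. pose proof e_pos. pose proof poh_floor_pos. pose proof drop_rate_pos. pose proof U_floor_pos.
assert (Hk3 : 0 <= flux_const).
{ apply Rmult_le_pos; [apply Rlt_le, Rinv_0_lt_compat; lra|]. apply Rmult_le_pos; apply pw_ge0. }
assert (Hk4 : 0 <= source_const).
{ apply Rmult_le_pos; [apply Rlt_le, Rinv_0_lt_compat; lra|]. apply pw_ge0. }
destruct (pw_decay flux_gap flux_const (poh_floor / 4) flux_gap_pos ltac:(lra) Hk3) as [L1 [HL1 Hx1]].
destruct (pw_decay source_gap source_const (poh_floor / 4) source_gap_pos ltac:(lra) Hk4) as [L2 [HL2 Hx2]].
set (L := Rmax L1 L2).
assert (HLL1 : L1 <= L) by apply Rmax_l. assert (HLL2 : L2 <= L) by apply Rmax_r.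
assert (HE : 0 < poh_err L).
{ pose proof poh_coef_pos. unfold poh_err.
  assert (0 < pw L (B + 1)) by (apply pw_pos; lra).
  assert (0 < pw L (B + 1) / (B + 1)) by (apply Rdiv_lt_0_compat; lra).
  assert (0 < poh_coef * (pw L (B + 1) / (B + 1))) by (now apply Rmult_lt_0_compat).
  apply Rmult_lt_0_compat; [|lra].
  apply Rmult_lt_0_compat; apply pw_pos; [apply Rinv_0_lt_compat; lra | lra]. }
assert (HEL : 0 < poh_err L * L) by (apply Rmult_lt_0_compat; lra).
exists L, (w_floor L), (poh_floor / 4 / (poh_err L * L)).
split; [lra|]. split.
{ apply pw_pos. apply Rmult_lt_0_compat; [apply Rmult_lt_0_compat; lra|].
  apply Rmult_lt_0_compat; apply pw_pos; lra. }
split; [apply Rdiv_lt_0_compat; lra|].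
intros w U c Hs.
pose proof (pohozaev_lower L _ _ w U c ltac:(lra) Hs (Rle_refl _)) as Hlo.
pose proof (pohozaev_upper L _ _ w U c ltac:(lra) Hs) as Hup.
replace (poh_floor / 4 / (poh_err L * L) * poh_err L * L) with (poh_floor / 4) in Hlo by (field; split; lra).
pose proof (Hx1 L HLL1). pose proof (Hx2 L HLL2). lra.
Qed.

End Liouville.

(** * Limits of Euler schemes *)

(** One shape of estimate has two uses. With [s = eps = M / 2] it says that increments of [x] lie
    between 0 and [M] times those of [mu]; with [eps] small it says that [x] has derivative close to
    [s] with respect to [mu]. *)
Lemma telescope (x mu : nat -> R) (s eps : R) (i j : nat) : (i <= j)%nat ->
  (forall k, (i <= k < j)%nat ->
    Rabs (x (S k) - x k - s * (mu (S k) - mu k)) <= eps * (mu (S k) - mu k)) ->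
  Rabs (x j - x i - s * (mu j - mu i)) <= eps * (mu j - mu i).
Proof.
intros Hij. induction Hij as [|j Hij IH]; intros H.
- replace (x i - x i - s * (mu i - mu i)) with 0 by ring. rewrite Rabs_R0. lra.
- assert (IH' := IH ltac:(intros k Hk; apply H; lia)).
  pose proof (H j ltac:(lia)) as Hj.
  replace (x (S j) - x i - s * (mu (S j) - mu i))
    with ((x (S j) - x j - s * (mu (S j) - mu j)) + (x j - x i - s * (mu j - mu i))) by ring.
  eapply Rle_trans; [apply Rabs_triang|]. lra.
Qed.

Lemma continuous_eps (f : R -> R) (x eps : R) : continuous f x -> 0 < eps ->
  exists delta, 0 < delta /\ forall y, Rabs (y - x) < delta -> Rabs (f y - f x) < eps.
Proof.
intros Hf He. destruct (proj1 (filterlim_locally f (f x)) Hf (mkposreal eps He)) as [d Hd].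
exists d. split; [apply cond_pos|]. intros y Hy. exact (Hd y Hy).
Qed.

Lemma continuous_of_eps (f : R -> R) (x : R) :
  (forall eps, 0 < eps -> exists delta, 0 < delta /\
    forall y, Rabs (y - x) < delta -> Rabs (f y - f x) < eps) -> continuous f x.
Proof.
intros H. apply filterlim_locally. intros eps. destruct (H eps (cond_pos eps)) as [d [Hd Hf]].
exists (mkposreal d Hd). intros y Hy. exact (Hf y Hy).
Qed.

(** Differentiation with respect to [mu], followed by the chain rule: the increments of [f - s * mu]
    are negligible against those of [mu], which are at most linear near [r0]. *)
Lemma is_derive_of_increments (f mu : R -> R) (r0 s dmu : R) :
  (forall x y, x <= y -> mu x <= mu y) -> is_derive mu r0 dmu ->
  (forall eps, 0 < eps -> exists delta, 0 < delta /\
    forall x y, r0 - delta < x -> x < y -> y < r0 + delta ->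
      Rabs (f y - f x - s * (mu y - mu x)) <= eps * (mu y - mu x)) ->
  is_derive f r0 (s * dmu).
Proof.
intros Hmu Hd H.
apply (is_derive_ext (fun t => s * mu t + (f t - s * mu t))); [intros t; simpl; ring|].
replace (s * dmu) with (s * dmu + 0) by ring.
apply is_derive_Rplus; [now apply is_derive_Rscal|].
apply is_derive_Reals. intros eps He.
apply is_derive_Reals in Hd. destruct (Hd 1 Rlt_0_1) as [d1 Hd1].
pose proof (Rabs_pos dmu) as Hdm.
assert (He' : 0 < eps / 2 / (Rabs dmu + 1)) by (repeat apply Rdiv_lt_0_compat; lra).
destruct (H _ He') as [d2 [Hd2 Hinc]].
assert (Hmin : 0 < Rmin d1 d2) by (apply Rmin_glb_lt; [apply cond_pos | easy]).
exists (mkposreal _ Hmin). intros h Hh0 Hh. simpl in Hh.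
assert (Hh1 : Rabs h < d1) by (eapply Rlt_le_trans; [exact Hh | apply Rmin_l]).
assert (Hh2 : Rabs h < d2) by (eapply Rlt_le_trans; [exact Hh | apply Rmin_r]).
assert (Hmuh : Rabs (mu (r0 + h) - mu r0) <= (Rabs dmu + 1) * Rabs h).
{ pose proof (Hd1 h Hh0 Hh1) as Hq.
  replace (mu (r0 + h) - mu r0) with (((mu (r0 + h) - mu r0) / h) * h) by (field; easy).
  rewrite Rabs_mult. apply Rmult_le_compat_r; [apply Rabs_pos|].
  replace ((mu (r0 + h) - mu r0) / h) with (((mu (r0 + h) - mu r0) / h - dmu) + dmu) by ring.
  eapply Rle_trans; [apply Rabs_triang|]. lra. }
assert (Hfh : Rabs (f (r0 + h) - s * mu (r0 + h) - (f r0 - s * mu r0))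
  <= eps / 2 / (Rabs dmu + 1) * Rabs (mu (r0 + h) - mu r0)).
{ apply Rabs_lt_between in Hh2. destruct (Rlt_le_dec 0 h) as [Hp|Hn].
  - rewrite (Rabs_pos_eq (mu _ - _)) by (pose proof (Hmu r0 (r0 + h) ltac:(lra)); lra).
    replace (f (r0 + h) - s * mu (r0 + h) - (f r0 - s * mu r0))
      with (f (r0 + h) - f r0 - s * (mu (r0 + h) - mu r0)) by ring.
    apply Hinc; lra.
  - rewrite (Rabs_left1 (mu _ - _)) by (pose proof (Hmu (r0 + h) r0 ltac:(lra)); lra).
    rewrite <- Rabs_Ropp.
    replace (- (f (r0 + h) - s * mu (r0 + h) - (f r0 - s * mu r0)))
      with (f r0 - f (r0 + h) - s * (mu r0 - mu (r0 + h))) by ring.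
    rewrite Ropp_minus_distr. apply Hinc; lra. }
rewrite Rminus_0_r. unfold Rdiv at 1. rewrite Rabs_mult, Rabs_inv.
assert (Hha : 0 < Rabs h) by (now apply Rabs_pos_lt).
apply (Rmult_lt_reg_r (Rabs h)); [easy|]. rewrite Rmult_assoc, Rinv_l, Rmult_1_r by lra.
eapply Rle_lt_trans; [exact Hfh|].
apply Rle_lt_trans with (eps / 2 / (Rabs dmu + 1) * ((Rabs dmu + 1) * Rabs h)).
- apply Rmult_le_compat_l; lra.
- replace (eps / 2 / (Rabs dmu + 1) * ((Rabs dmu + 1) * Rabs h)) with (eps / 2 * Rabs h) by (field; lra).
  apply Rmult_lt_compat_r; lra.
Qed.

(** * Explicit Euler schemes and their uniform bounds *)

Section Euler.

Context (Phi : R -> R -> R -> R) (f mu dmu : R -> R) (Rad dlo hi M Mf : R).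
Context (HRad : 0 < Rad) (HM : 0 <= M) (HMf : 0 <= Mf).
Context (Hmu : forall x y, x <= y -> mu x <= mu y) (Hmuc : forall x, continuous mu x).
Context (Hdmu : forall r, 0 < r -> is_derive mu r (dmu r)).
Context (Hfc : forall x, continuous f x) (Hf : forall v, v <= hi -> 0 <= f v <= Mf).
Context (HPhi0 : forall v W, Phi 0 v W = 0).
Context (HPhic : forall r v W, 0 < r -> forall eps, 0 < eps -> exists delta, 0 < delta /\
  forall r' v' W', Rabs (r' - r) < delta -> Rabs (v' - v) < delta -> Rabs (W' - W) < delta ->
    Rabs (Phi r' v' W' - Phi r v W) < eps).
Context (HPhib : forall r v W, 0 <= r <= Rad -> v <= hi -> 0 <= W <= Mf * (mu r - mu 0) ->
  0 <= Phi r v W <= M).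

(** With [n + 1] steps the mesh makes sense for [n = 0]; the last node, [Rad], has index [S n]. *)
Definition step (n : nat) := Rad / (INR n + 1).

(** The weight in the equation for [W] is integrated exactly, through increments of [mu]: its
    density [r^B] may be singular at 0, since only [B > -1] is guaranteed in the application. *)
Fixpoint euler (n : nat) (d : R) (k : nat) : R * R :=
  match k with
  | O => (d, 0)
  | S k =>
      let (v, W) := euler n d k in
      (v - step n * Phi (step n * INR k) v W,
       W + (mu (step n * INR (S k)) - mu (step n * INR k)) * f v)
  end.

Definition ev n d k := fst (euler n d k).
Definition eW n d k := snd (euler n d k).

Lemma ev_S n d k : ev n d (S k) = ev n d k - step n * Phi (step n * INR k) (ev n d k) (eW n d k).
Proof. unfold ev, eW. simpl. now destruct (euler n d k). Qed.

Lemma eW_S n d k :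
  eW n d (S k) = eW n d k + (mu (step n * INR (S k)) - mu (step n * INR k)) * f (ev n d k).
Proof. unfold ev, eW. simpl euler. now destruct (euler n d k). Qed.

Lemma step_pos n : 0 < step n.
Proof. apply Rdiv_lt_0_compat; [easy|]. pose proof (pos_INR n); lra. Qed.

Lemma node_le n k : (k <= S n)%nat -> 0 <= step n * INR k <= Rad.
Proof.
intros Hk. pose proof (step_pos n). pose proof (pos_INR k). apply le_INR in Hk. rewrite S_INR in Hk.
split; [apply Rmult_le_pos; lra|].
apply Rle_trans with (step n * (INR n + 1)); [apply Rmult_le_compat_l; lra|].
unfold step. right. field. pose proof (pos_INR n); lra.
Qed.

Lemma node_S n k : step n * INR (S k) = step n * INR k + step n.
Proof. rewrite S_INR. ring. Qed.

(** This region is invariant under the scheme, and it is where [Hf] and [HPhib] bound the right-hand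
    sides. *)
Lemma euler_inv n d k : d <= hi -> (k <= S n)%nat ->
  ev n d k <= hi /\ 0 <= eW n d k <= Mf * (mu (step n * INR k) - mu 0).
Proof.
intros Hd. pose proof (step_pos n) as Hst. induction k as [|k IH]; intros Hk.
- unfold ev, eW. simpl. rewrite Rmult_0_r. lra.
- destruct (IH ltac:(lia)) as [Hv HW]. rewrite ev_S, eW_S.
  pose proof (HPhib _ _ _ (node_le n k ltac:(lia)) Hv HW) as HP. split.
  + assert (0 <= step n * Phi (step n * INR k) (ev n d k) (eW n d k)) by (apply Rmult_le_pos; lra). lra.
  + pose proof (Hmu (step n * INR k) (step n * INR (S k)) ltac:(rewrite node_S; lra)).
    pose proof (Hf _ Hv).
    assert (0 <= (mu (step n * INR (S k)) - mu (step n * INR k)) * f (ev n d k))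
      by (apply Rmult_le_pos; lra).
    assert ((mu (step n * INR (S k)) - mu (step n * INR k)) * f (ev n d k)
      <= (mu (step n * INR (S k)) - mu (step n * INR k)) * Mf) by (apply Rmult_le_compat_l; lra).
    lra.
Qed.

Lemma slope_bound n d k : d <= hi -> (k <= S n)%nat ->
  0 <= Phi (step n * INR k) (ev n d k) (eW n d k) <= M.
Proof.
intros Hd Hk. destruct (euler_inv n d k Hd Hk). apply HPhib; try easy. now apply node_le.
Qed.

Lemma continuous_euler n k d : continuous (fun d => ev n d k) d /\ continuous (fun d => eW n d k) d.
Proof.
induction k as [|k [IHv IHW]].
- split; [apply continuous_id | apply continuous_const].
- split.
  + apply continuous_ext with (fun d => ev n d k - step n * Phi (step n * INR k) (ev n d k) (eW n d k)).
    { intros x. now rewrite ev_S. }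
    apply continuous_Rminus; [easy|]. apply continuous_Rscal.
    destruct (pos_INR k) as [Hk|Hk].
    * apply continuous_of_eps. intros eps He.
      destruct (HPhic (step n * INR k) (ev n d k) (eW n d k)
        ltac:(apply Rmult_lt_0_compat; [apply step_pos | easy]) eps He) as [dd [Hdd HP]].
      destruct (continuous_eps _ _ _ IHv Hdd) as [d1 [Hd1 H1]].
      destruct (continuous_eps _ _ _ IHW Hdd) as [d2 [Hd2 H2]].
      exists (Rmin d1 d2). split; [now apply Rmin_glb_lt|]. intros y Hy.
      apply HP; [|apply H1|apply H2].
      -- rewrite Rminus_diag, Rabs_R0. easy.
      -- eapply Rlt_le_trans; [exact Hy | apply Rmin_l].
      -- eapply Rlt_le_trans; [exact Hy | apply Rmin_r].
    (* At the node 0, where [HPhic] says nothing, the increment of [v] vanishes by [HPhi0]. *)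
    * rewrite <- Hk. apply continuous_ext with (fun _ => 0); [|apply continuous_const].
      intros x. now rewrite Rmult_0_r, HPhi0.
  + apply continuous_ext with
      (fun d => eW n d k + (mu (step n * INR (S k)) - mu (step n * INR k)) * f (ev n d k)).
    { intros x. now rewrite eW_S. }
    apply continuous_Rplus; [easy|]. apply continuous_Rscal.
    apply (continuous_comp (fun d => ev n d k) f); [easy | apply Hfc].
Qed.

(** Limit functions are evaluated at [clamp x]: they become constant outside [[0, Rad]], so that
    continuity can be asked on the whole line. *)
Definition clamp x := Rmax 0 (Rmin x Rad).

Lemma clamp_bounds x : 0 <= clamp x <= Rad.
Proof.
unfold clamp. split; [apply Rmax_l|]. apply Rmax_lub; [lra | apply Rmin_r].
Qed.

Lemma clamp_id x : 0 <= x <= Rad -> clamp x = x.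
Proof. intros Hx. unfold clamp. rewrite Rmin_left, Rmax_right; lra. Qed.

Lemma index_ex n x : exists k, (k <= S n)%nat /\ Rabs (step n * INR k - clamp x) <= step n.
Proof.
pose proof (step_pos n) as Hst. pose proof (clamp_bounds x) as Hc.
destruct (nfloor_ex (clamp x / step n)) as [k Hk].
{ apply Rdiv_le_0_compat; lra. }
assert (H1 : INR k * step n <= clamp x).
{ destruct Hk as [Hk _].
  apply (Rmult_le_compat_r (step n)) in Hk; [|lra].
  unfold Rdiv in Hk. rewrite Rmult_assoc, Rinv_l in Hk by lra. lra. }
assert (H2 : clamp x < (INR k + 1) * step n).
{ destruct Hk as [_ Hk]. apply (Rmult_lt_compat_r (step n)) in Hk; [|lra].
  unfold Rdiv in Hk. rewrite Rmult_assoc, Rinv_l in Hk by lra. lra. }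
exists k. split.
- apply INR_le. rewrite S_INR. apply (Rmult_le_reg_r (step n)); [easy|].
  apply Rle_trans with (1 := H1). apply Rle_trans with Rad; [lra|].
  unfold step. right. field. pose proof (pos_INR n); lra.
- apply Rabs_le. lra.
Qed.

Definition idx n x := proj1_sig (constructive_indefinite_description _ (index_ex n x)).

Lemma idx_spec n x : (idx n x <= S n)%nat /\ Rabs (step n * INR (idx n x) - clamp x) <= step n.
Proof. exact (proj2_sig (constructive_indefinite_description _ (index_ex n x))). Qed.

Context (G : (nat -> Prop) -> Prop) (HG : free_ultrafilter G).

Lemma step_small eps : 0 < eps -> G (fun n => step n < eps).
Proof.
intros He. destruct (nfloor_ex (Rad / eps)) as [N [_ HN]]; [apply Rdiv_le_0_compat; lra|].
apply (ultra_mono G HG (fun n => (N <= n)%nat)); [|apply (ultra_tail G HG)].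
intros n Hn. apply le_INR in Hn. unfold step. pose proof (pos_INR n).
apply (Rmult_lt_reg_r (INR n + 1)); [lra|]. unfold Rdiv. rewrite Rmult_assoc, Rinv_l, Rmult_1_r by lra.
apply (Rmult_lt_compat_r eps) in HN; [|easy]. unfold Rdiv in HN. rewrite Rmult_assoc, Rinv_l in HN by lra.
assert (eps * INR N <= eps * INR n) by (apply Rmult_le_compat_l; lra). lra.
Qed.

Lemma node_near (x eps : R) : 0 <= x <= Rad -> 0 < eps ->
  G (fun n => Rabs (step n * INR (idx n x) - x) < eps).
Proof.
intros Hx He. apply (ultra_mono G HG _ _) with (2 := step_small eps He).
intros n Hn. destruct (idx_spec n x) as [_ H]. rewrite (clamp_id x) in H by easy. lra.
Qed.

(** Nodewise estimates are summed and passed to the limit. The nodes chosen for [x] and [y] may lie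
    slightly outside [[x, y]], hence the margin [delta] in the hypothesis. *)
Lemma ulim_increment (X : nat -> nat -> R) (nu l : R -> R) (s eps delta x y : R) :
  (forall x, continuous nu x) ->
  (forall x, ulim G (fun n => X n (idx n x)) (l x)) -> 0 <= eps ->
  0 < delta -> 0 <= x -> x < y -> y <= Rad ->
  G (fun n => forall k, (k <= n)%nat -> x - delta < step n * INR k -> step n * INR (S k) < y + delta ->
    Rabs (X n (S k) - X n k - s * (nu (step n * INR (S k)) - nu (step n * INR k)))
      <= eps * (nu (step n * INR (S k)) - nu (step n * INR k))) ->
  Rabs (l y - l x - s * (nu y - nu x)) <= eps * (nu y - nu x).
Proof.
intros Hnu Hl He Hd Hx Hxy Hy H.
apply Rle_plus_epsilon. intros eta Heta.
pose proof (Rabs_pos s) as Hs.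
(* Replacing nodal values by limits costs [e1] at each of the four places; the denominator makes the
   total equal to [eta]. *)
set (e1 := eta / (2 + 2 * Rabs s + 2 * eps)).
assert (He1 : 0 < e1) by (apply Rdiv_lt_0_compat; lra).
assert (Hnear : forall z, 0 <= z <= Rad -> G (fun n => Rabs (nu (step n * INR (idx n z)) - nu z) < e1)).
{ intros z Hz. destruct (continuous_eps nu z e1 (Hnu z) He1) as [d [Hdd Hc]].
  apply (ultra_mono G HG _ _) with (2 := node_near z d Hz Hdd). intros n. apply Hc. }
(* Within half the distance, the two nodes stay in order. *)
assert (Hdd : 0 < Rmin delta ((y - x) / 2)) by (apply Rmin_glb_lt; lra).
destruct (ultra_ex G HG _ (ultra_and G HG _ _ H (ultra_and G HG _ _
  (ultra_and G HG _ _ (Hl x e1 He1) (Hl y e1 He1))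
  (ultra_and G HG _ _ (ultra_and G HG _ _ (Hnear x ltac:(lra)) (Hnear y ltac:(lra)))
    (ultra_and G HG _ _ (node_near x _ ltac:(lra) Hdd) (node_near y _ ltac:(lra) Hdd))))))
  as [n [Hn [[Hlx Hly] [[Hnx Hny] [Hix Hiy]]]]].
assert (Hm1 := Rmin_l delta ((y - x) / 2)). assert (Hm2 := Rmin_r delta ((y - x) / 2)).
apply Rabs_lt_between' in Hix. apply Rabs_lt_between' in Hiy.
pose proof (step_pos n) as Hst.
assert (Hle : (idx n x <= idx n y)%nat).
{ apply INR_le. apply (Rmult_le_reg_l (step n)); lra. }
assert (Ht := telescope (X n) (fun k => nu (step n * INR k)) s eps _ _ Hle). cbv beta in Ht.
assert (Ht' : Rabs (X n (idx n y) - X n (idx n x) - s * (nu (step n * INR (idx n y)) - nu (step n * INR (idx n x))))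
  <= eps * (nu (step n * INR (idx n y)) - nu (step n * INR (idx n x)))).
{ apply Ht. intros k Hk. destruct (idx_spec n y) as [Hky _]. apply Hn; [lia| |].
  - apply Rlt_le_trans with (step n * INR (idx n x)); [lra|].
    apply Rmult_le_compat_l; [lra|]. apply le_INR; lia.
  - apply Rle_lt_trans with (step n * INR (idx n y)); [|lra].
    apply Rmult_le_compat_l; [lra|]. apply le_INR; lia. }
clear Ht. set (Nx := nu (step n * INR (idx n x))) in *. set (Ny := nu (step n * INR (idx n y))) in *.
set (Xx := X n (idx n x)) in *. set (Xy := X n (idx n y)) in *.
replace (l y - l x - s * (nu y - nu x)) with
  ((Xy - Xx - s * (Ny - Nx)) + (- (Xy - l y) + ((Xx - l x) + s * ((Ny - nu y) - (Nx - nu x))))) by ring.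
eapply Rle_trans; [apply Rabs_triang|].
assert (Ha : Rabs (- (Xy - l y) + ((Xx - l x) + s * ((Ny - nu y) - (Nx - nu x)))) <= e1 + (e1 + Rabs s * (e1 + e1))).
{ eapply Rle_trans; [apply Rabs_triang|]. rewrite Rabs_Ropp. apply Rplus_le_compat; [lra|].
  eapply Rle_trans; [apply Rabs_triang|]. apply Rplus_le_compat; [lra|].
  rewrite Rabs_mult. apply Rmult_le_compat_l; [easy|].
  unfold Rminus at 1. eapply Rle_trans; [apply Rabs_triang|]. rewrite Rabs_Ropp. lra. }
apply Rabs_lt_between' in Hnx. apply Rabs_lt_between' in Hny.
assert (Hb : eps * (Ny - Nx) <= eps * ((nu y - nu x) + 2 * e1)) by (apply Rmult_le_compat_l; lra).
assert (Hc : e1 * (2 + 2 * Rabs s + 2 * eps) = eta) by (unfold e1; field; lra).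
lra.
Qed.

Lemma ev_step n d k : d <= hi -> (k <= n)%nat ->
  Rabs (ev n d (S k) - ev n d k - - (M / 2) * (step n * INR (S k) - step n * INR k))
    <= M / 2 * (step n * INR (S k) - step n * INR k).
Proof.
intros Hd Hk. rewrite ev_S, node_S. pose proof (step_pos n).
pose proof (slope_bound n d k Hd ltac:(lia)) as Hb.
set (P := Phi (step n * INR k) (ev n d k) (eW n d k)) in *.
replace (ev n d k - step n * P - ev n d k - - (M / 2) * (step n * INR k + step n - step n * INR k))
  with (step n * (M / 2 - P)) by field.
replace (M / 2 * (step n * INR k + step n - step n * INR k)) with (step n * (M / 2)) by ring.
rewrite Rabs_mult, Rabs_pos_eq by lra. apply Rmult_le_compat_l; [lra|]. apply Rabs_le. lra.
Qed.

Lemma eW_step n d k : d <= hi -> (k <= n)%nat ->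
  Rabs (eW n d (S k) - eW n d k - Mf / 2 * (mu (step n * INR (S k)) - mu (step n * INR k)))
    <= Mf / 2 * (mu (step n * INR (S k)) - mu (step n * INR k)).
Proof.
intros Hd Hk. rewrite eW_S. pose proof (step_pos n).
destruct (euler_inv n d k Hd ltac:(lia)) as [Hv _]. pose proof (Hf _ Hv).
pose proof (Hmu (step n * INR k) (step n * INR (S k)) ltac:(rewrite node_S; lra)) as Hm.
set (D := mu (step n * INR (S k)) - mu (step n * INR k)) in *.
assert (HD : 0 <= D) by (unfold D; lra).
replace (eW n d k + D * f (ev n d k) - eW n d k - Mf / 2 * D) with (D * (f (ev n d k) - Mf / 2)) by ring.
rewrite Rabs_mult, Rabs_pos_eq by lra. rewrite (Rmult_comm (Mf / 2)).
apply Rmult_le_compat_l; [lra|]. apply Rabs_le. lra.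
Qed.

Lemma ev_lip n d i j : d <= hi -> (i <= S n)%nat -> (j <= S n)%nat ->
  Rabs (ev n d i - ev n d j) <= M * Rabs (step n * INR i - step n * INR j).
Proof.
intros Hd.
assert (Hij : forall i j, (i <= j <= S n)%nat ->
  Rabs (ev n d i - ev n d j) <= M * Rabs (step n * INR i - step n * INR j)).
{ intros i' j' [H1 H2].
  assert (Ht := telescope (ev n d) (fun k => step n * INR k) (- (M / 2)) (M / 2) i' j' H1
    ltac:(intros k Hk; apply ev_step; [easy | lia])). cbv beta in Ht.
  apply Rabs_le_between in Ht.
  assert (step n * INR i' <= step n * INR j').
  { pose proof (step_pos n). apply Rmult_le_compat_l; [lra | now apply le_INR]. }
  rewrite (Rabs_left1 (step n * _ - _)) by lra. apply Rabs_le. lra. }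
intros Hi Hj. destruct (Nat.le_ge_cases i j) as [H|H]; [apply Hij; lia|].
rewrite Rabs_minus_sym, (Rabs_minus_sym (step n * INR i)). apply Hij; lia.
Qed.

Lemma eW_lip n d i j : d <= hi -> (i <= S n)%nat -> (j <= S n)%nat ->
  Rabs (eW n d i - eW n d j) <= Mf * Rabs (mu (step n * INR i) - mu (step n * INR j)).
Proof.
intros Hd.
assert (Hij : forall i j, (i <= j <= S n)%nat ->
  Rabs (eW n d i - eW n d j) <= Mf * Rabs (mu (step n * INR i) - mu (step n * INR j))).
{ intros i' j' [H1 H2].
  assert (Ht := telescope (eW n d) (fun k => mu (step n * INR k)) (Mf / 2) (Mf / 2) i' j' H1
    ltac:(intros k Hk; apply eW_step; [easy | lia])). cbv beta in Ht.
  apply Rabs_le_between in Ht.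
  assert (mu (step n * INR i') <= mu (step n * INR j')).
  { pose proof (step_pos n). apply Hmu, Rmult_le_compat_l; [lra | now apply le_INR]. }
  rewrite (Rabs_left1 (mu _ - _)) by lra. apply Rabs_le. lra. }
intros Hi Hj. destruct (Nat.le_ge_cases i j) as [H|H]; [apply Hij; lia|].
rewrite Rabs_minus_sym, (Rabs_minus_sym (mu (step n * INR i))). apply Hij; lia.
Qed.

(** * Passage to the limit along the ultrafilter *)

Section Limit.

Context (d : nat -> R) (Hd : forall n, dlo <= d n <= hi) (lv lW : R -> R).
Context (Hlv : forall x, ulim G (fun n => ev n (d n) (idx n x)) (lv x)).
Context (HlW : forall x, ulim G (fun n => eW n (d n) (idx n x)) (lW x)).

(** Equicontinuity: [ev_lip] and [eW_lip] have constants independent of [n], so convergence at the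
    single point [r0] controls all nodal values in a neighbourhood of fixed size. *)
Lemma euler_near r0 eps : 0 <= r0 <= Rad -> 0 < eps -> exists delta, 0 < delta /\
  G (fun n => forall k, (k <= S n)%nat -> Rabs (step n * INR k - r0) < delta ->
    Rabs (step n * INR k - r0) < eps /\
    Rabs (ev n (d n) k - lv r0) < eps /\ Rabs (eW n (d n) k - lW r0) < eps).
Proof.
intros Hr He.
assert (He1 : 0 < eps / 4 / (Mf + 1)) by (repeat apply Rdiv_lt_0_compat; lra).
assert (He2 : 0 < eps / 4 / (M + 1)) by (repeat apply Rdiv_lt_0_compat; lra).
destruct (continuous_eps mu r0 _ (Hmuc r0) He1) as [d1 [Hd1 Hm1]].
set (delta := Rmin (Rmin d1 eps) (eps / 4 / (M + 1))).
assert (Hdel : 0 < delta) by (repeat apply Rmin_glb_lt; easy).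
assert (Hdel1 : delta <= d1) by (eapply Rle_trans; [apply Rmin_l | apply Rmin_l]).
assert (Hdel2 : delta <= eps) by (eapply Rle_trans; [apply Rmin_l | apply Rmin_r]).
assert (Hdel3 : delta <= eps / 4 / (M + 1)) by apply Rmin_r.
exists delta. split; [easy|].
assert (He4 : 0 < eps / 4) by lra.
apply (ultra_mono G HG _ _) with (2 := ultra_and G HG _ _ (node_near r0 delta Hr Hdel)
  (ultra_and G HG _ _ (Hlv r0 _ He4) (HlW r0 _ He4))).
intros n [Hn [Hv HW]] k Hk Hkr. destruct (idx_spec n r0) as [Hi _].
pose proof (ev_lip n (d n) k (idx n r0) (proj2 (Hd n)) Hk Hi) as Lv.
pose proof (eW_lip n (d n) k (idx n r0) (proj2 (Hd n)) Hk Hi) as LW.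
assert (Hmk := Hm1 _ (Rlt_le_trans _ _ _ Hkr Hdel1)).
assert (Hmi := Hm1 _ (Rlt_le_trans _ _ _ Hn Hdel1)).
split; [lra|]. split.
- assert (Hx : Rabs (step n * INR k - step n * INR (idx n r0)) <= 2 * (eps / 4 / (M + 1))).
  { replace (step n * INR k - step n * INR (idx n r0))
      with ((step n * INR k - r0) + - (step n * INR (idx n r0) - r0)) by ring.
    eapply Rle_trans; [apply Rabs_triang|]. rewrite Rabs_Ropp. lra. }
  apply (Rmult_le_compat_l M) in Hx; [|easy].
  replace (ev n (d n) k - lv r0) with
    ((ev n (d n) k - ev n (d n) (idx n r0)) + (ev n (d n) (idx n r0) - lv r0)) by ring.
  eapply Rle_lt_trans; [apply Rabs_triang|].
  assert (M * (2 * (eps / 4 / (M + 1))) <= (M + 1) * (2 * (eps / 4 / (M + 1)))) by (apply Rmult_le_compat_r; lra).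
  replace ((M + 1) * (2 * (eps / 4 / (M + 1)))) with (eps / 2) in H by (field; lra). lra.
- assert (Hx : Rabs (mu (step n * INR k) - mu (step n * INR (idx n r0))) <= 2 * (eps / 4 / (Mf + 1))).
  { replace (mu (step n * INR k) - mu (step n * INR (idx n r0)))
      with ((mu (step n * INR k) - mu r0) + - (mu (step n * INR (idx n r0)) - mu r0)) by ring.
    eapply Rle_trans; [apply Rabs_triang|]. rewrite Rabs_Ropp. lra. }
  apply (Rmult_le_compat_l Mf) in Hx; [|easy].
  replace (eW n (d n) k - lW r0) with
    ((eW n (d n) k - eW n (d n) (idx n r0)) + (eW n (d n) (idx n r0) - lW r0)) by ring.
  eapply Rle_lt_trans; [apply Rabs_triang|].
  assert (Mf * (2 * (eps / 4 / (Mf + 1))) <= (Mf + 1) * (2 * (eps / 4 / (Mf + 1)))) by (apply Rmult_le_compat_r; lra).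
  replace ((Mf + 1) * (2 * (eps / 4 / (Mf + 1)))) with (eps / 2) in H by (field; lra). lra.
Qed.

(** Stated for both components: [v] has [nu] the identity and [psi = - Phi], while [W] has [nu = mu]
    and [psi = f]. Near [r0] the factor [psi] is almost constant by [euler_near], so increments of
    [X] are almost proportional to those of [nu]. *)
Lemma limit_derive (X : nat -> nat -> R) (nu l : R -> R) (dnu r0 : R) (psi : R -> R -> R -> R) :
  (forall x y, x <= y -> nu x <= nu y) -> (forall x, continuous nu x) -> is_derive nu r0 dnu ->
  (forall x, ulim G (fun n => X n (idx n x)) (l x)) ->
  (forall n k, X n (S k) = X n k + (nu (step n * INR (S k)) - nu (step n * INR k))
     * psi (step n * INR k) (ev n (d n) k) (eW n (d n) k)) ->
  0 < r0 < Rad ->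
  (forall eps, 0 < eps -> exists delta, 0 < delta /\
    forall r' v' W', Rabs (r' - r0) < delta -> Rabs (v' - lv r0) < delta -> Rabs (W' - lW r0) < delta ->
      Rabs (psi r' v' W' - psi r0 (lv r0) (lW r0)) < eps) ->
  is_derive (fun x => l (clamp x)) r0 (psi r0 (lv r0) (lW r0) * dnu).
Proof.
intros Hnu Hnuc Hdnu Hl HX Hr Hpsi.
apply is_derive_of_increments with (mu := nu); [easy | easy |].
intros eps He. destruct (Hpsi eps He) as [d0 [Hd0 Hp]].
destruct (euler_near r0 d0 ltac:(lra) Hd0) as [d1 [Hd1 Hn]].
set (delta := Rmin (d1 / 2) (Rmin r0 (Rad - r0))).
assert (0 < delta) by (repeat apply Rmin_glb_lt; lra).
assert (delta <= d1 / 2) by apply Rmin_l.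
assert (delta <= r0) by (eapply Rle_trans; [apply Rmin_r | apply Rmin_l]).
assert (delta <= Rad - r0) by (eapply Rle_trans; [apply Rmin_r | apply Rmin_r]).
exists delta. split; [easy|]. intros x y Hx Hxy Hy.
rewrite !clamp_id by lra.
apply (ulim_increment X nu l _ eps delta); try easy; try lra.
apply (ultra_mono G HG _ _) with (2 := Hn). intros n Hk k Hkn Hkx Hky.
rewrite HX. rewrite node_S in Hky. pose proof (step_pos n).
destruct (Hk k ltac:(lia)) as [Ha [Hb Hc]].
{ apply Rabs_lt_between'. lra. }
pose proof (Hp _ _ _ Ha Hb Hc) as Hq.
pose proof (Hnu (step n * INR k) (step n * INR (S k)) ltac:(rewrite node_S; lra)) as Hm.
set (D := nu (step n * INR (S k)) - nu (step n * INR k)) in *.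
assert (HD : 0 <= D) by (unfold D; lra).
replace (X n k + D * psi (step n * INR k) (ev n (d n) k) (eW n (d n) k) - X n k - psi r0 (lv r0) (lW r0) * D)
  with (D * (psi (step n * INR k) (ev n (d n) k) (eW n (d n) k) - psi r0 (lv r0) (lW r0))) by ring.
rewrite Rabs_mult, Rabs_pos_eq by easy. rewrite Rmult_comm. apply Rmult_le_compat_r; lra.
Qed.

End Limit.

(** The initial height varies with [n] because the intermediate value theorem is applied to each
    scheme separately. *)
Theorem euler_limit (d : nat -> R) : (forall n, dlo <= d n <= hi) ->
  exists v W : R -> R,
    dlo <= v 0 <= hi /\ ulim G (fun n => ev n (d n) (S n)) (v Rad) /\
    (forall x, v x = v (clamp x)) /\ (forall x, W x = W (clamp x)) /\
    W 0 = 0 /\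
    (forall x y, 0 <= x -> x <= y -> y <= Rad -> 0 <= v x - v y <= M * (y - x)) /\
    (forall x y, 0 <= x -> x <= y -> y <= Rad -> 0 <= W y - W x <= Mf * (mu y - mu x)) /\
    (forall r, 0 < r < Rad -> is_derive v r (- Phi r (v r) (W r))) /\
    (forall r, 0 < r < Rad -> is_derive W r (f (v r) * dmu r)).
Proof.
intros Hd.
assert (Hexv : forall x, exists l, ulim G (fun n => ev n (d n) (idx n x)) l).
{ intros x. apply (ulim_ex G HG _ (dlo - M * Rad) hi). intros n.
  destruct (idx_spec n x) as [Hi _]. destruct (Hd n) as [Hd1 Hd2]. split.
  - pose proof (ev_lip n (d n) (idx n x) 0 Hd2 Hi ltac:(lia)) as H.
    change (ev n (d n) 0) with (d n) in H. simpl INR in H. rewrite Rmult_0_r, Rminus_0_r in H.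
    pose proof (node_le n _ Hi). rewrite (Rabs_pos_eq (step n * _)) in H by lra.
    assert (M * (step n * INR (idx n x)) <= M * Rad) by (apply Rmult_le_compat_l; lra).
    apply Rabs_le_between' in H. lra.
  - apply euler_inv; easy. }
assert (HexW : forall x, exists l, ulim G (fun n => eW n (d n) (idx n x)) l).
{ intros x. apply (ulim_ex G HG _ 0 (Mf * (mu Rad - mu 0))). intros n.
  destruct (idx_spec n x) as [Hi _]. destruct (euler_inv n (d n) _ (proj2 (Hd n)) Hi) as [_ HW].
  split; [easy|]. apply (Rle_trans _ _ _ (proj2 HW)). apply Rmult_le_compat_l; [easy|].
  pose proof (Hmu _ _ (proj2 (node_le n _ Hi))). lra. }
destruct (functional_choice _ Hexv) as [lv Hlv]. destruct (functional_choice _ HexW) as [lW HlW].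
assert (HvI : forall x y, 0 <= x -> x <= y -> y <= Rad -> 0 <= lv x - lv y <= M * (y - x)).
{ intros x y Hx [Hxy|Hxy] Hy; [|subst; lra].
  assert (H := ulim_increment (fun n => ev n (d n)) (fun t => t) lv (- (M / 2)) (M / 2) 1 x y
    (fun t => continuous_id t) Hlv ltac:(lra) Rlt_0_1 Hx Hxy Hy). cbv beta in H.
  apply Rabs_le_between in H; [lra|].
  apply (ultra_mono G HG _ _) with (2 := ultra_tail G HG 0). intros n _ k Hk _ _.
  apply ev_step; [apply Hd | easy]. }
assert (HWI : forall x y, 0 <= x -> x <= y -> y <= Rad -> 0 <= lW y - lW x <= Mf * (mu y - mu x)).
{ intros x y Hx [Hxy|Hxy] Hy; [|subst; lra].
  assert (H := ulim_increment (fun n => eW n (d n)) mu lW (Mf / 2) (Mf / 2) 1 x y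
    Hmuc HlW ltac:(lra) Rlt_0_1 Hx Hxy Hy). cbv beta in H.
  apply Rabs_le_between in H; [lra|].
  apply (ultra_mono G HG _ _) with (2 := ultra_tail G HG 0). intros n _ k Hk _ _.
  apply eW_step; [apply Hd | easy]. }
(* The limits are defined through [idx], which need not select the extreme indices 0 and [S n] at
   the two ends. *)
assert (Hend : forall r k, 0 <= r <= Rad -> (forall n, (k n <= S n)%nat /\ step n * INR (k n) = r) ->
  ulim G (fun n => ev n (d n) (k n)) (lv r) /\ ulim G (fun n => eW n (d n) (k n)) (lW r)).
{ intros r k Hr Hk. split; intros eps He;
  destruct (euler_near d Hd lv lW Hlv HlW r eps Hr He) as [dd [Hdd Hn]];
  apply (ultra_mono G HG _ _) with (2 := Hn); intros n Hnk; destruct (Hk n) as [Hk1 Hk2];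
  apply (Hnk _ Hk1); rewrite Hk2, Rminus_diag, Rabs_R0; exact Hdd. }
destruct (Hend 0 (fun _ => O) ltac:(lra)) as [H0v H0W].
{ intros n. split; [lia | simpl; ring]. }
destruct (Hend Rad (fun n => S n) ltac:(lra)) as [HRv _].
{ intros n. split; [lia|]. rewrite S_INR. unfold step. field. pose proof (pos_INR n); lra. }
exists (fun x => lv (clamp x)), (fun x => lW (clamp x)).
assert (HcR : clamp Rad = Rad) by (apply clamp_id; lra).
assert (Hc0 : clamp 0 = 0) by (apply clamp_id; lra).
assert (Hcc : forall x, clamp (clamp x) = clamp x) by (intros x; apply clamp_id, clamp_bounds).
split.
{ rewrite Hc0. split.
  - apply (ulim_ge G HG _ _ _ H0v). apply (ultra_mono G HG _ _) with (2 := ultra_tail G HG 0).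
    intros n _. apply Hd.
  - apply (ulim_le G HG _ _ _ H0v). apply (ultra_mono G HG _ _) with (2 := ultra_tail G HG 0).
    intros n _. apply Hd. }
split; [rewrite HcR; exact HRv|].
split; [intros x; now rewrite Hcc|].
split; [intros x; now rewrite Hcc|].
split.
{ rewrite Hc0. apply Rle_antisym.
  - apply (ulim_le G HG _ _ _ H0W). apply (ultra_mono G HG _ _) with (2 := ultra_tail G HG 0).
    intros n _. apply Rle_refl.
  - apply (ulim_ge G HG _ _ _ H0W). apply (ultra_mono G HG _ _) with (2 := ultra_tail G HG 0).
    intros n _. apply Rle_refl. }
split; [intros x y Hx Hxy Hy; rewrite !clamp_id by lra; now apply HvI|].
split; [intros x y Hx Hxy Hy; rewrite !clamp_id by lra; now apply HWI|].
split.
- intros r Hr. rewrite (clamp_id r) by lra.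
  replace (- Phi r (lv r) (lW r)) with (- Phi r (lv r) (lW r) * 1) by ring.
  apply (limit_derive d Hd lv lW Hlv HlW (fun n => ev n (d n)) (fun t => t) lv 1 r
    (fun r v W => - Phi r v W)).
  + easy.
  + intros x; apply continuous_id.
  + apply is_derive_Rid.
  + exact Hlv.
  + intros n k. rewrite ev_S, node_S. ring.
  + exact Hr.
  + intros eps He. destruct (HPhic r (lv r) (lW r) (proj1 Hr) eps He) as [dd [Hdd Hc]].
    exists dd. split; [easy|]. intros r' v' W' H1 H2 H3.
    replace (- Phi r' v' W' - - Phi r (lv r) (lW r)) with (- (Phi r' v' W' - Phi r (lv r) (lW r))) by ring.
    rewrite Rabs_Ropp. now apply Hc.
- intros r Hr. rewrite (clamp_id r) by lra.
  apply (limit_derive d Hd lv lW Hlv HlW (fun n => eW n (d n)) mu lW (dmu r) r (fun r v W => f v)).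
  + easy.
  + easy.
  + apply Hdmu; lra.
  + exact HlW.
  + intros n k. apply eW_S.
  + exact Hr.
  + intros eps He. destruct (continuous_eps f (lv r) eps (Hfc _) He) as [dd [Hdd Hc]].
    exists dd. split; [easy|]. intros r' v' W' _ H2 _. now apply Hc.
Qed.

End Euler.

(** * The Dirichlet problem *)

Section Radial.

Context (m A B p ga e th c1 c2 Rad : R) (a g : R -> R).
Context (Hm : 1 < m) (HA : 0 < A + 1 - m) (HB : 0 < B + 1 - A) (Hp : m - 1 < p).
Context (Hga : 0 < ga < m - 1) (He : e * (m - 1) = 1) (Hth : th = ga * e).
Context (Hsub : (p + 1 - th) * (A + 1 - m) < m * (1 - th) * (B + 1)).
Context (HRad : 0 < Rad) (Hc1 : 0 < c1) (Ha : forall r, c1 <= a r <= c2) (Hac : forall r, continuous a r).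
Context (Hg0 : forall v, 0 <= g v) (Hgm : forall s t, s <= t -> g s <= g t) (Hgc : forall v, continuous g v).
Context (Hglim : is_lim (fun s => g s / s) p_infty 1).

(** * The initial value problem for the radial system *)

Definition Phi r v W := pw (pw r (- A) * pw (a r + g v) ga * W) e.
Definition mu r := pw r (B + 1) / (B + 1).
Definition Mc hi := pw (pw (c2 + g hi) ga * (pw hi p * / (B + 1))) e.

Lemma F_pos r v : 0 < a r + g v.
Proof. pose proof (Ha r); pose proof (Hg0 v); lra. Qed.

Lemma Phi_0 v W : Phi 0 v W = 0.
Proof. unfold Phi. rewrite (pw_npos 0), !Rmult_0_l, pw_npos; lra. Qed.

(** The bound on [W], of order [r^(B+1)], outweighs the singular factor [r^(-A)]. The exponent
    [(B+1-A) e] is positive, so the slope is bounded and tends to 0 at the origin, whence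
    [v'(0) = 0]. *)
Lemma Phi_bound hi r v W : 0 <= r -> v <= hi -> 0 <= W <= pw hi p * mu r ->
  0 <= Phi r v W <= Mc hi * pw r ((B + 1 - A) * e).
Proof.
intros [Hr|Hr] Hv HW.
2:{ subst r. rewrite Phi_0, (pw_npos 0) by lra. lra. }
pose proof (e_pos m e Hm He) as Hep.
assert (Hi : 0 <= / (B + 1)) by (apply Rlt_le, Rinv_0_lt_compat; lra).
split; [apply pw_ge0|]. unfold Phi, Mc. rewrite <- pw_pw, <- pw_mult.
- apply pw_le; [lra|].
  apply Rle_trans with (pw r (- A) * pw (c2 + g hi) ga * (pw hi p * mu r)).
  + apply Rmult_le_compat; [apply Rmult_le_pos; apply pw_ge0 | lra | | lra].
    apply Rmult_le_compat_l; [apply pw_ge0|]. apply pw_le; [lra|].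
    pose proof (Ha r). pose proof (Hgm v hi Hv). lra.
  + right. unfold mu, Rdiv. replace (B + 1 - A) with (- A + (B + 1)) by ring. rewrite (pw_plus r (- A)). ring.
- apply Rmult_le_pos; [apply pw_ge0|]. apply Rmult_le_pos; [apply pw_ge0 | easy].
- apply pw_ge0.
Qed.

Lemma Phi_continuous r v W : 0 < r ->
  continuous (fun z : R * (R * R) => Phi (fst z) (fst (snd z)) (snd (snd z))) (r, (v, W)).
Proof.
intros Hr. unfold Phi. apply continuous_pw_comp; [now apply (e_pos m)|].
assert (H1 : continuous (fun z : R * (R * R) => fst z) (r, (v, W))) by apply continuous_fst.
assert (H2 : continuous (fun z : R * (R * R) => fst (snd z)) (r, (v, W))).
{ apply (continuous_comp snd fst); [apply continuous_snd | apply continuous_fst]. }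
assert (H3 : continuous (fun z : R * (R * R) => snd (snd z)) (r, (v, W))).
{ apply (continuous_comp snd snd); apply continuous_snd. }
apply continuous_Rmult; [apply continuous_Rmult|exact H3].
- apply continuous_pw_comp_pos; [exact Hr | exact H1].
- apply continuous_pw_comp_pos; [apply F_pos|]. apply continuous_Rplus.
  + apply (continuous_comp (fun z : R * (R * R) => fst z) a); [exact H1 | apply Hac].
  + apply (continuous_comp (fun z : R * (R * R) => fst (snd z)) g); [exact H2 | apply Hgc].
Qed.

Lemma Phi_eps r v W : 0 < r -> forall eps, 0 < eps -> exists delta, 0 < delta /\
  forall r' v' W', Rabs (r' - r) < delta -> Rabs (v' - v) < delta -> Rabs (W' - W) < delta ->
    Rabs (Phi r' v' W' - Phi r v W) < eps.
Proof.
intros Hr eps Heps.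
pose proof (proj1 (filterlim_locally _ _) (Phi_continuous r v W Hr) (mkposreal eps Heps)) as [d Hd].
exists d. split; [apply cond_pos|]. intros r' v' W' H1 H2 H3.
apply (Hd (r', (v', W'))). split; [exact H1|]. split; [exact H2 | exact H3].
Qed.

Lemma mu_mono x y : x <= y -> mu x <= mu y.
Proof.
intros H. apply Rmult_le_compat_r; [apply Rlt_le, Rinv_0_lt_compat; lra|]. apply pw_le; lra.
Qed.

Lemma mu_0 : mu 0 = 0.
Proof. unfold mu. rewrite pw_npos by lra. unfold Rdiv. ring. Qed.

(* Powers being truncated, the system makes sense after v has become negative. *)
Record ivp_solution (D : R) (v W : R -> R) : Prop := {
  ivp_v0 : v 0 = D;
  ivp_W0 : W 0 = 0;
  ivp_vc : forall x, continuous v x;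
  ivp_Wc : forall x, continuous W x;
  ivp_v_le : forall r, 0 <= r <= Rad -> v r <= D;
  ivp_W_le : forall r, 0 <= r <= Rad -> 0 <= W r <= pw D p * mu r;
  ivp_dv : forall r, 0 < r < Rad -> is_derive v r (- Phi r (v r) (W r));
  ivp_dW : forall r, 0 < r < Rad -> is_derive W r (pw (v r) p * pw r B) }.

Definition endpoint n d := ev Phi (fun v => pw v p) mu Rad n d (S n).

Lemma clamp_lip Rd x y : 0 < Rd -> Rabs (clamp Rd x - clamp Rd y) <= Rabs (x - y).
Proof.
intros H. unfold clamp, Rmax, Rmin.
repeat destruct Rle_dec; try lra; unfold Rabs; repeat destruct Rcase_abs; lra.
Qed.

Lemma ivp_limit (G : (nat -> Prop) -> Prop) (HG : free_ultrafilter G) (d : nat -> R) (dlo hi : R) :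
  0 <= dlo -> (forall n, dlo <= d n <= hi) ->
  exists D v W, dlo <= D <= hi /\ ulim G (fun n => endpoint n (d n)) (v Rad) /\ ivp_solution D v W.
Proof.
intros Hlo Hd.
assert (Hhi : 0 <= hi) by (pose proof (Hd O); lra).
assert (HMc : 0 <= Mc hi) by apply pw_ge0.
pose proof (e_pos m e Hm He) as Hep.
assert (HBA : 0 <= (B + 1 - A) * e) by (apply Rmult_le_pos; lra).
assert (Hpp : 0 < p) by lra.
assert (HM : 0 <= Mc hi * pw Rad ((B + 1 - A) * e)) by (apply Rmult_le_pos; [easy | apply pw_ge0]).
assert (Hmuc : forall x, continuous mu x) by (intros x; apply (continuous_mu m A B Hm HA HB)).
destruct (euler_limit Phi (fun v => pw v p) mu (fun r => pw r B) Rad dlo hi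
  (Mc hi * pw Rad ((B + 1 - A) * e)) (pw hi p) HRad HM (pw_ge0 _ _) mu_mono Hmuc
  (fun r => is_derive_mu m A B Hm HA HB r)
  (fun x => continuous_pw x p Hpp)
  (fun v Hv => conj (pw_ge0 _ _) (pw_le _ _ _ (Rlt_le _ _ Hpp) Hv))
  Phi_eps) with (G := G) (d := d)
  as [v [W [H1 [H3 [Hvc [HWc [HW0 [Hv [HW [Hdv HdW]]]]]]]]]]; try assumption.
{ intros r v W Hr Hv HW. rewrite mu_0, Rminus_0_r in HW.
  destruct (Phi_bound hi r v W ltac:(lra) Hv HW) as [Hb1 Hb2].
  split; [easy|]. apply (Rle_trans _ _ _ Hb2). apply Rmult_le_compat_l; [easy|]. apply pw_le; lra. }
exists (v 0), v, W. split; [easy|]. split; [easy|].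
assert (Hvcc : forall x, continuous v x).
{ intros x. apply continuous_of_eps. intros eps Heps.
  set (M := Mc hi * pw Rad ((B + 1 - A) * e)) in *.
  exists (eps / (M + 1)). split; [apply Rdiv_lt_0_compat; lra|].
  intros y Hy. rewrite (Hvc x), (Hvc y).
  pose proof (clamp_lip Rad y x HRad) as Hcl.
  pose proof (clamp_bounds Rad HRad x). pose proof (clamp_bounds Rad HRad y).
  assert (Hq : Rabs (v (clamp Rad y) - v (clamp Rad x)) <= M * Rabs (clamp Rad y - clamp Rad x)).
  { destruct (Rle_lt_dec (clamp Rad x) (clamp Rad y)).
    - rewrite (Rabs_pos_eq (clamp Rad y - _)) by lra. apply Rabs_le.
      pose proof (Hv (clamp Rad x) (clamp Rad y) ltac:(lra) ltac:(lra) ltac:(lra)). lra.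
    - rewrite (Rabs_left (clamp Rad y - _)) by lra. apply Rabs_le.
      pose proof (Hv (clamp Rad y) (clamp Rad x) ltac:(lra) ltac:(lra) ltac:(lra)). lra. }
  assert (M * Rabs (clamp Rad y - clamp Rad x) <= M * Rabs (y - x)) by (apply Rmult_le_compat_l; lra).
  pose proof (Rabs_pos (y - x)).
  apply (Rmult_lt_compat_l (M + 1)) in Hy; [|lra].
  replace ((M + 1) * (eps / (M + 1))) with eps in Hy by (field; lra). lra. }
assert (HWcc : forall x, continuous W x).
{ intros x. apply continuous_of_eps. intros eps Heps.
  set (Mf := pw hi p) in *. pose proof (pw_ge0 hi p : 0 <= Mf) as HMf.
  assert (Heps' : 0 < eps / (Mf + 1)) by (apply Rdiv_lt_0_compat; lra).
  destruct (continuous_eps mu (clamp Rad x) _ (Hmuc _) Heps') as [dd [Hdd Hmd]].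
  exists dd. split; [easy|].
  intros y Hy. rewrite (HWc x), (HWc y).
  pose proof (Hmd (clamp Rad y) (Rle_lt_trans _ _ _ (clamp_lip Rad y x HRad) Hy)) as Hcl.
  pose proof (clamp_bounds Rad HRad x). pose proof (clamp_bounds Rad HRad y).
  assert (Hq : Rabs (W (clamp Rad y) - W (clamp Rad x)) <= Mf * Rabs (mu (clamp Rad y) - mu (clamp Rad x))).
  { destruct (Rle_lt_dec (clamp Rad x) (clamp Rad y)) as [Hxy|Hxy].
    - pose proof (mu_mono _ _ Hxy). rewrite (Rabs_pos_eq (mu (clamp Rad y) - _)) by lra. apply Rabs_le.
      pose proof (HW (clamp Rad x) (clamp Rad y) ltac:(lra) ltac:(lra) ltac:(lra)). lra.
    - pose proof (mu_mono _ _ (Rlt_le _ _ Hxy)). rewrite (Rabs_left1 (mu (clamp Rad y) - _)) by lra. apply Rabs_le.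
      pose proof (HW (clamp Rad y) (clamp Rad x) ltac:(lra) ltac:(lra) ltac:(lra)). lra. }
  pose proof (Rabs_pos (mu (clamp Rad y) - mu (clamp Rad x))).
  apply (Rmult_lt_compat_l (Mf + 1)) in Hcl; [|lra].
  replace ((Mf + 1) * (eps / (Mf + 1))) with eps in Hcl by (field; lra). lra. }
assert (Hv0 : forall r, 0 <= r <= Rad -> v r <= v 0).
{ intros r Hr. pose proof (Hv 0 r ltac:(lra) ltac:(lra) ltac:(lra)). lra. }
constructor; try easy.
intros r Hr. split.
{ pose proof (HW 0 r ltac:(lra) ltac:(lra) ltac:(lra)). lra. }
(* [euler_limit] bounds [W] in terms of [hi]; integrating with [v <= v 0] gives the bound in terms
   of the actual height. *)
assert (Hmon : 0 <= (pw (v 0) p * mu r - W r) - (pw (v 0) p * mu 0 - W 0)).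
{ assert (Hnd := nondecreasing_of_derive (fun x => pw (v 0) p * mu x - W x)
    (fun x => pw (v 0) p * pw x B - pw (v x) p * pw x B) 0 r ltac:(lra)). cbv beta in Hnd.
  assert (pw (v 0) p * mu 0 - W 0 <= pw (v 0) p * mu r - W r); [|lra]. apply Hnd; clear Hnd.
  - intros x Hx. apply continuous_Rminus; [apply continuous_Rscal, Hmuc | apply HWcc].
  - intros x Hx. apply is_derive_Rminus; [|apply HdW; lra].
    apply is_derive_Rscal. apply (is_derive_mu m A B Hm HA HB). lra.
  - intros x Hx. rewrite <- Rmult_minus_distr_r. apply Rmult_le_pos; [|apply pw_ge0].
    pose proof (pw_le (v x) (v 0) p ltac:(lra) (Hv0 x ltac:(lra))). lra. }
rewrite mu_0, HW0 in Hmon. lra.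
Qed.

Lemma endpoint_continuous n d : continuous (endpoint n) d.
Proof.
assert (Hpp : 0 < p) by lra.
unfold endpoint. apply (continuous_euler Phi (fun v => pw v p) mu Rad); try easy.
- intros x. now apply continuous_pw.
- apply Phi_0.
- apply Phi_eps.
Qed.

(** From a height [d0 <= 1] a scheme falls by at most [C * d0^(p e)], and [p e > 1] because
    [p > m - 1]. [pw_decay], used with [d0 = / L], makes this at most [d0 / 2] for every mesh. *)
Lemma endpoint_pos : exists d0, 0 < d0 /\ d0 <= 1 /\ forall n, 0 < endpoint n d0.
Proof.
pose proof (e_pos m e Hm He) as Hep.
assert (Hpe : 0 < p * e - 1).
{ assert ((m - 1) * e < p * e) by (apply Rmult_lt_compat_r; lra). lra. }
assert (HBA : 0 <= (B + 1 - A) * e) by (apply Rmult_le_pos; lra).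
assert (Hc2 : 0 < c2) by (pose proof (Ha 0); lra).
assert (Hi : 0 <= / (B + 1)) by (apply Rlt_le, Rinv_0_lt_compat; lra).
set (C := pw (pw (c2 + g 1) ga * / (B + 1)) e * pw Rad ((B + 1 - A) * e) * Rad).
assert (HC : 0 <= C) by (apply Rmult_le_pos; [apply Rmult_le_pos; apply pw_ge0 | lra]).
destruct (pw_decay (p * e - 1) C (1 / 2) Hpe ltac:(lra) HC) as [L [HL HLd]].
set (d0 := / L).
assert (Hd0 : 0 < d0) by (apply Rinv_0_lt_compat; lra).
assert (Hd1 : d0 <= 1) by (unfold d0; rewrite <- Rinv_1; apply Rinv_le_contravar; lra).
exists d0. split; [easy|]. split; [easy|]. intros n.
assert (HMc : Mc d0 * pw Rad ((B + 1 - A) * e) * Rad <= d0 / 2).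
{ apply Rle_trans with (C * pw d0 (p * e)).
  - unfold C, Mc.
    replace (pw (pw (c2 + g 1) ga * / (B + 1)) e * pw Rad ((B + 1 - A) * e) * Rad * pw d0 (p * e))
      with ((pw (pw (c2 + g 1) ga * / (B + 1)) e * pw d0 (p * e)) * pw Rad ((B + 1 - A) * e) * Rad) by ring.
    apply Rmult_le_compat_r; [lra|]. apply Rmult_le_compat_r; [apply pw_ge0|].
    rewrite <- pw_pw, <- pw_mult by (first [apply pw_ge0 | apply Rmult_le_pos; [apply pw_ge0 | easy]]).
    apply pw_le; [lra|]. rewrite (Rmult_comm (pw d0 p)), <- Rmult_assoc.
    apply Rmult_le_compat_r; [apply pw_ge0|]. apply Rmult_le_compat_r; [easy|].
    apply pw_le; [lra|]. pose proof (Hgm d0 1 Hd1). lra.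
  - replace (p * e) with ((p * e - 1) + 1) by ring. rewrite pw_plus1 by lra.
    specialize (HLd L (Rle_refl L)). rewrite <- pw_inv_l in HLd by lra. fold d0 in HLd.
    rewrite <- Rmult_assoc. apply Rle_trans with (1 / 2 * d0); [|lra]. apply Rmult_le_compat_r; lra. }
assert (Hlip := ev_lip Phi (fun v => pw v p) mu Rad d0 (Mc d0 * pw Rad ((B + 1 - A) * e)) (pw d0 p)
  HRad mu_mono (fun v Hv => conj (pw_ge0 _ _) (pw_le _ _ _ (ltac:(lra) : 0 <= p) Hv))).
assert (Hb : forall r v W, 0 <= r <= Rad -> v <= d0 -> 0 <= W <= pw d0 p * (mu r - mu 0) ->
  0 <= Phi r v W <= Mc d0 * pw Rad ((B + 1 - A) * e)).
{ intros r v W Hr Hv HW. rewrite mu_0, Rminus_0_r in HW.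
  destruct (Phi_bound d0 r v W ltac:(lra) Hv HW) as [Hb1 Hb2].
  split; [easy|]. apply (Rle_trans _ _ _ Hb2). apply Rmult_le_compat_l; [apply pw_ge0|]. apply pw_le; lra. }
specialize (Hlip Hb n d0 (S n) O (Rle_refl _) (le_n _) ltac:(lia)).
fold (endpoint n d0) in Hlip. change (ev Phi (fun v => pw v p) mu Rad n d0 0) with d0 in Hlip.
pose proof (node_le Rad HRad n (S n) (le_n _)) as Hnd.
simpl (INR 0) in Hlip. rewrite Rmult_0_r, Rminus_0_r in Hlip.
rewrite (Rabs_pos_eq (step Rad n * _)) in Hlip by lra.
assert (Mc d0 * pw Rad ((B + 1 - A) * e) * (step Rad n * INR (S n)) <= Mc d0 * pw Rad ((B + 1 - A) * e) * Rad).
{ apply Rmult_le_compat_l; [apply Rmult_le_pos; apply pw_ge0 | lra]. }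
apply Rabs_le_between' in Hlip. lra.
Qed.

(** * Growth of a + g(v), and the blow-up argument *)

Lemma g_ratio eps : 0 < eps -> exists T, 1 <= T /\ forall v, T <= v -> Rabs (g v / v - 1) < eps.
Proof.
intros Heps. apply is_lim_spec in Hglim. destruct (Hglim (mkposreal eps Heps)) as [T HT].
exists (Rmax 1 (T + 1)). split; [apply Rmax_l|]. intros v Hv. apply HT.
apply Rlt_le_trans with (T + 1); [lra|]. apply Rle_trans with (2 := Hv). apply Rmax_r.
Qed.

Lemma F_bounds : exists c3 T, 0 < c3 /\ 1 <= T /\ (forall r v, 0 <= v -> c3 * v <= a r + g v) /\
  forall v, T <= v -> g v <= 2 * v.
Proof.
destruct (g_ratio (1 / 2) ltac:(lra)) as [T [HT Hr]].
assert (Hv : forall v, T <= v -> v / 2 <= g v <= 2 * v).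
{ intros v Hv. specialize (Hr v Hv). apply Rabs_lt_between in Hr.
  replace (g v) with (g v / v * v) by (field; lra).
  assert (1 / 2 * v <= g v / v * v) by (apply Rmult_le_compat_r; lra).
  assert (g v / v * v <= 2 * v) by (apply Rmult_le_compat_r; lra). lra. }
assert (Hq : 0 < c1 / T) by (apply Rdiv_lt_0_compat; lra).
(* Above [T] the lower bound comes from [g v >= v / 2], below [T] from [a r >= c1]. *)
exists (Rmin (1 / 2) (c1 / T)), T. split; [apply Rmin_glb_lt; lra|]. split; [easy|]. split.
- intros r v Hv0. pose proof (Ha r). destruct (Rle_lt_dec T v) as [HTv|HvT].
  + pose proof (Hv v HTv). pose proof (Rmin_l (1 / 2) (c1 / T)) as Hmin.
    apply (Rmult_le_compat_r v) in Hmin; lra.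
  + pose proof (Hg0 v). pose proof (Rmin_r (1 / 2) (c1 / T)) as Hmin.
    apply (Rmult_le_compat_r v) in Hmin; [|easy].
    assert (c1 / T * v <= c1 / T * T) by (apply Rmult_le_compat_l; lra).
    replace (c1 / T * T) with c1 in * by (field; lra). lra.
- intros v HTv. apply Hv, HTv.
Qed.

Lemma F_ratio eps : 0 < eps -> exists T, 1 <= T /\
  forall r v, T <= v -> Rabs (pw ((a r + g v) / v) th - 1) <= eps.
Proof.
intros Heps.
destruct (continuous_eps (fun t => pw t th) 1 eps (continuous_pw_pos 1 th Rlt_0_1) Heps) as [d [Hd Hc]].
destruct (g_ratio (d / 2) ltac:(lra)) as [T [HT Hr]].
assert (Hc2 : 0 < c2) by (pose proof (Ha 0); lra).
assert (Hq : 0 < 2 * (c2 + 1) / d) by (apply Rdiv_lt_0_compat; lra).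
(* Beyond [2 (c2 + 1) / d] the quotient [a r / v] is below [d / 2]; the other half is left for
   [g v / v - 1]. *)
exists (T + 2 * (c2 + 1) / d). split; [lra|]. intros r v Hv.
apply Rlt_le. cbv beta in Hc. rewrite pw_1 in Hc. apply Hc.
replace ((a r + g v) / v - 1) with (a r / v + (g v / v - 1)) by (field; lra).
eapply Rle_lt_trans; [apply Rabs_triang|].
specialize (Hr v ltac:(lra)). pose proof (Ha r).
assert (Hv1 : a r / v < d / 2).
{ apply (Rmult_lt_reg_r v); [lra|]. unfold Rdiv at 1. rewrite Rmult_assoc, Rinv_l, Rmult_1_r by lra.
  assert (Hx : 2 * (c2 + 1) / d <= v) by lra.
  apply (Rmult_le_compat_l (d / 2)) in Hx; [|lra].
  replace (d / 2 * (2 * (c2 + 1) / d)) with (c2 + 1) in Hx by (field; lra). lra. }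
assert (0 <= a r / v) by (apply Rlt_le, Rdiv_lt_0_compat; lra).
rewrite (Rabs_pos_eq (a r / v)) by easy. lra.
Qed.

Lemma is_derive_dilation (f : R -> R) (lam y df : R) : is_derive f (lam * y) df ->
  is_derive (fun t => f (lam * t)) y (lam * df).
Proof.
intros H. evar_last.
- apply (is_derive_comp f (fun t => lam * t)); [exact H|]. apply is_derive_Rscal, is_derive_Rid.
- simpl. unfold scal; simpl; unfold mult; simpl. ring.
Qed.

Lemma blow_up : exists D, 1 <= D /\ forall v W, ivp_solution D v W -> ~ (forall r, 0 <= r < Rad -> 0 < v r).
Proof.
pose proof (e_pos m e Hm He) as Hep. pose proof (th_bounds m ga e th Hm Hga He Hth) as Hthb.
assert (Hc2 : 0 < c2) by (pose proof (Ha 0); lra).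
destruct F_bounds as [c3 [T0 [Hc3 [HT0 [Hlow Hup]]]]].
(* The value [c2 + 2] bounds [(a + g(v)) / D], because [v <= D], [D >= 1] and [g D <= 2 D]. *)
destruct (no_rescaled_solution m A B p ga e th c3 (c2 + 2) Hm HA HB Hp Hga He Hth Hsub Hc3 ltac:(lra))
  as [L [eta [eps [HL [Heta [Heps Hno]]]]]].
destruct (F_ratio eps Heps) as [T1 [HT1 Hrat]].
(* Chosen so that the rescaled system has no parameters apart from c. *)
set (kap := (ga + p - (m - 1)) / (B - A + m)).
assert (Hkap : 0 < kap) by (apply Rdiv_lt_0_compat; lra).
destruct (pw_decay kap (2 * L) (Rad / 2) Hkap ltac:(lra) ltac:(lra)) as [T2 [HT2 Hsmall]].
assert (HT1e : 0 < T1 / eta) by (apply Rdiv_lt_0_compat; lra).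
(* [T0] ensures [g D <= 2 D]; [T1 / eta] turns [w >= eta] into [v >= T1], where [F_ratio] applies;
   [T2] makes the rescaled interval [[0, 2L]] fit inside [[0, Rad)]. *)
set (D := T0 + T1 / eta + T2).
assert (HD : 1 <= D) by (unfold D; lra).
exists D. split; [easy|]. intros v W Hs Hpos.
set (lam := pw D (- kap)).
assert (Hlam : 0 < lam) by (apply pw_pos; lra).
specialize (Hsmall D ltac:(unfold D; lra)). fold lam in Hsmall.
assert (Hin : forall y, 0 <= y <= 2 * L -> 0 <= lam * y < Rad).
{ intros y Hy. split; [apply Rmult_le_pos; lra|].
  apply Rle_lt_trans with (lam * (2 * L)); [apply Rmult_le_compat_l; lra | lra]. }
assert (Hin' : forall y, 0 < y < 2 * L -> 0 < lam * y < Rad).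
{ intros y Hy. split; [apply Rmult_lt_0_compat; lra | apply Hin; lra]. }
(* The scale of [W] dictated by [W' = r^B v^p] under [r = lam * y] and [v = D * w]. *)
set (K := pw lam (B + 1) * pw D p).
assert (HK : 0 < K) by (apply Rmult_lt_0_compat; apply pw_pos; lra).
apply (Hno (fun y => / D * v (lam * y)) (fun y => / K * W (lam * y))
  (fun y => (a (lam * y) + g (v (lam * y))) / D)).
assert (HDi : 0 < / D) by (apply Rinv_0_lt_compat; lra).
assert (Hcont : forall f : R -> R, (forall x, continuous f x) -> forall y, continuous (fun t => f (lam * t)) y).
{ intros f Hf y. apply (continuous_comp (fun t => lam * t) f); [|apply Hf].
  apply continuous_Rscal, continuous_id. }
constructor.
- rewrite Rmult_0_r, (ivp_v0 _ _ _ Hs). field; lra.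
- rewrite Rmult_0_r, (ivp_W0 _ _ _ Hs). ring.
- intros y _. apply continuous_Rscal, Hcont, (ivp_vc _ _ _ Hs).
- intros y _. apply continuous_Rscal, Hcont, (ivp_Wc _ _ _ Hs).
- intros y Hy. apply Rmult_lt_0_compat; [easy|]. now apply Hpos, Hin.
- intros y Hy. evar_last.
  + apply is_derive_Rscal, is_derive_dilation, (ivp_dv _ _ _ Hs), Hin', Hy.
  + unfold Phi.
    set (F := a (lam * y) + g (v (lam * y))). pose proof (F_pos (lam * y) (v (lam * y)) : 0 < F) as HF.
    pose proof (ivp_W_le _ _ _ Hs (lam * y) ltac:(pose proof (Hin' y Hy); lra)) as [HW0 _].
    set (Wy := W (lam * y)) in *.
    assert (HWy : Wy = K * (/ K * Wy)) by (field; lra).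
    assert (HU0 : 0 <= / K * Wy) by (apply Rmult_le_pos; [apply Rlt_le, Rinv_0_lt_compat|]; lra).
    assert (HFy : F = D * (F / D)) by (field; lra).
    assert (HFD : 0 < F / D) by (now apply Rdiv_lt_0_compat; lra).
    rewrite HWy at 1. rewrite HFy at 1.
    rewrite (pw_mult lam y), (pw_mult D (F / D)) by lra. unfold K at 1.
    set (U := / K * Wy) in *. set (c := F / D) in *. clearbody U c.
    replace (pw lam (- A) * pw y (- A) * (pw D ga * pw c ga) * (pw lam (B + 1) * pw D p * U))
      with ((pw lam (- A) * pw lam (B + 1) * (pw D ga * pw D p)) * (pw y (- A) * pw c ga * U)) by ring.
    rewrite pw_mult by (repeat apply Rmult_le_pos; try apply pw_ge0; easy).
    rewrite <- !pw_plus. rewrite pw_mult, !pw_pw by apply pw_ge0.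
    (* By the choice of [kap] the total exponent of [D] is 0. *)
    assert (Hscale : / D * lam * (pw lam ((- A + (B + 1)) * e) * pw D ((ga + p) * e)) = 1).
    { unfold lam. rewrite pw_pw. rewrite <- (pw_x1 D) at 1 by lra. rewrite <- pw_opp by lra.
      rewrite <- !pw_plus. transitivity (pw D 0); [f_equal | apply pw_x0; lra].
      apply (Rmult_eq_reg_r (m - 1)); [|lra].
      replace ((Ropp 1 + - kap + (- kap * ((- A + (B + 1)) * e) + (ga + p) * e)) * (m - 1))
        with (- (m - 1) - kap * (m - 1) - kap * (- A + (B + 1)) * (e * (m - 1)) + (ga + p) * (e * (m - 1))) by ring.
      rewrite He. unfold kap. field. lra. }
    match goal with |- / D * (lam * - (?x * ?z)) = - ?z' =>
      transitivity (- ((/ D * lam * x) * z)); [ring | rewrite Hscale; ring] end.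
- intros y Hy. evar_last.
  + apply is_derive_Rscal, is_derive_dilation, (ivp_dW _ _ _ Hs), Hin', Hy.
  + pose proof (Hpos _ (Hin y ltac:(lra))) as Hv.
    rewrite (pw_mult (/ D)), pw_inv_l, pw_opp, (pw_mult lam y) by lra. unfold K.
    rewrite (pw_plus1 lam B) by lra.
    assert (0 < pw lam B) by (now apply pw_pos). assert (0 < pw D p) by (apply pw_pos; lra).
    field. repeat split; lra.
- intros y Hy. pose proof (Hpos _ (Hin y ltac:(lra))) as Hv.
  replace (c3 * (/ D * v (lam * y))) with ((c3 * v (lam * y)) / D) by (unfold Rdiv; ring).
  apply Rmult_le_compat_r; [lra|]. apply Hlow; lra.
- intros y Hy. apply (Rmult_le_reg_r D); [lra|].
  unfold Rdiv. rewrite Rmult_assoc, Rinv_l, Rmult_1_r by lra.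
  pose proof (Ha (lam * y)). pose proof (Hup D ltac:(unfold D; lra)).
  pose proof (Hgm _ _ (ivp_v_le _ _ _ Hs (lam * y) ltac:(pose proof (Hin y ltac:(lra)); lra))).
  assert (c2 * 1 <= c2 * D) by (apply Rmult_le_compat_l; lra). lra.
- intros y Hy Hey. pose proof (Hpos _ (Hin y ltac:(lra))) as Hv.
  replace ((a (lam * y) + g (v (lam * y))) / D / (/ D * v (lam * y)))
    with ((a (lam * y) + g (v (lam * y))) / v (lam * y)) by (field; lra).
  apply Hrat.
  apply (Rmult_le_compat_l D) in Hey; [|lra]. rewrite <- Rmult_assoc, Rinv_r, Rmult_1_l in Hey by lra.
  apply Rle_trans with (2 := Hey). apply Rle_trans with (T1 / eta * eta); [right; field; lra|].
  apply Rmult_le_compat_r; [lra|]. unfold D. lra.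
Qed.

(** * Positivity and the boundary condition *)

Lemma ivp_W_pos D v W : 0 < D -> ivp_solution D v W -> forall r, 0 < r <= Rad -> 0 < W r.
Proof.
intros HD Hs r Hr.
destruct (continuous_eps v 0 (D / 2) (ivp_vc _ _ _ Hs 0) ltac:(lra)) as [d [Hd Hc]].
set (s := Rmin r (d / 2)).
assert (Hs0 : 0 < s) by (apply Rmin_glb_lt; lra).
assert (Hsr : s <= r) by apply Rmin_l. assert (Hsd : s <= d / 2) by apply Rmin_r.
assert (Hsv : forall x, 0 <= x <= s -> D / 2 <= v x).
{ intros x Hx. specialize (Hc x). rewrite Rminus_0_r, Rabs_pos_eq, (ivp_v0 _ _ _ Hs) in Hc by lra.
  specialize (Hc ltac:(lra)). apply Rabs_lt_between' in Hc. lra. }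
assert (H1 : pw (D / 2) p * mu s <= W s).
{ assert (Hnd := nondecreasing_of_derive (fun x => W x - pw (D / 2) p * mu x)
    (fun x => pw (v x) p * pw x B - pw (D / 2) p * pw x B) 0 s ltac:(lra)). cbv beta in Hnd.
  rewrite mu_0, (ivp_W0 _ _ _ Hs) in Hnd.
  assert (0 - pw (D / 2) p * 0 <= W s - pw (D / 2) p * mu s); [|lra]. apply Hnd; clear Hnd.
  - intros x Hx. apply continuous_Rminus; [apply (ivp_Wc _ _ _ Hs) | apply continuous_Rscal].
    apply (continuous_mu m A B Hm HA HB).
  - intros x Hx. apply is_derive_Rminus; [apply (ivp_dW _ _ _ Hs); lra|].
    apply is_derive_Rscal. apply (is_derive_mu m A B Hm HA HB). lra.
  - intros x Hx. rewrite <- Rmult_minus_distr_r. apply Rmult_le_pos; [|apply pw_ge0].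
    pose proof (pw_le (D / 2) (v x) p ltac:(lra) (Hsv x ltac:(lra))). lra. }
assert (H2 : W s <= W r).
{ apply (nondecreasing_of_derive W (fun x => pw (v x) p * pw x B)); [easy| | |].
  - intros; apply (ivp_Wc _ _ _ Hs).
  - intros; apply (ivp_dW _ _ _ Hs); lra.
  - intros; apply Rmult_le_pos; apply pw_ge0. }
assert (0 < pw (D / 2) p * mu s).
{ apply Rmult_lt_0_compat; [apply pw_pos; lra|]. apply Rdiv_lt_0_compat; [now apply pw_pos | lra]. }
lra.
Qed.

(** As [v] is nonincreasing, [v r <= 0 <= v Rad] would force [v = 0] on [[r, Rad]], while [W > 0]
    makes the derivative strictly negative there. *)
Lemma ivp_positive D v W : 0 < D -> ivp_solution D v W -> 0 <= v Rad ->
  forall r, 0 <= r < Rad -> 0 < v r.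
Proof.
intros HD Hs HvR. pose proof (ivp_W_pos D v W HD Hs) as HWpos.
assert (Hdec : forall x y, 0 <= x -> x <= y -> y <= Rad -> v y <= v x).
{ intros x y Hx Hxy Hy. apply Ropp_le_cancel.
  apply (nondecreasing_of_derive (fun x => - v x) (fun x => - - Phi x (v x) (W x))); [easy| | |].
  - intros; apply (continuous_opp v), (ivp_vc _ _ _ Hs).
  - intros z Hz. apply (is_derive_opp v), (ivp_dv _ _ _ Hs); lra.
  - intros; rewrite Ropp_involutive; apply pw_ge0. }
intros r Hr. destruct (Rlt_le_dec 0 (v r)) as [H|H]; [easy|]. exfalso.
assert (Hz : forall x, r <= x <= Rad -> v x = 0).
{ intros x Hx. pose proof (Hdec r x ltac:(lra) ltac:(lra) ltac:(lra)).
  pose proof (Hdec x Rad ltac:(lra) ltac:(lra) ltac:(lra)). lra. }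
set (x := (r + Rad) / 2).
assert (Hx : r < x < Rad) by (unfold x; lra).
pose proof (ivp_dv _ _ _ Hs x ltac:(lra)) as Hdv.
assert (H0 : is_derive v x 0).
{ apply is_derive_ext_loc with (fun _ => 0); [|apply is_derive_Rcst].
  assert (Hmin : 0 < Rmin (x - r) (Rad - x)) by (apply Rmin_glb_lt; lra).
  exists (mkposreal _ Hmin). intros t Ht. symmetry. apply Hz.
  unfold ball in Ht; simpl in Ht. unfold AbsRing_ball, abs, minus, plus, opp in Ht; simpl in Ht.
  apply Rabs_lt_between' in Ht. pose proof (Rmin_l (x - r) (Rad - x)). pose proof (Rmin_r (x - r) (Rad - x)). lra. }
assert (HP : 0 < Phi x (v x) (W x)).
{ apply pw_pos. apply Rmult_lt_0_compat; [apply Rmult_lt_0_compat|].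
  - apply pw_pos; lra.
  - apply pw_pos, F_pos.
  - apply HWpos; lra. }
pose proof (is_derive_unique _ _ _ Hdv). pose proof (is_derive_unique _ _ _ H0). lra.
Qed.

Theorem dirichlet_solution : exists D v W, 0 < D /\ ivp_solution D v W /\ v Rad = 0.
Proof.
destruct endpoint_pos as [d0 [Hd0 [Hd01 Hpos]]].
destruct blow_up as [D [HD Hblow]].
destruct free_ultrafilter_ex as [G HG].
destruct (ultra_em G HG (fun n => endpoint n D <= 0)) as [H|H].
(* [functional_choice] requires a height for every [n]; for the indices whose endpoint at [D] is
   positive it is [D] itself. *)
- assert (Hroot : forall n, exists d, d0 <= d <= D /\ (endpoint n D <= 0 -> endpoint n d = 0)).
  { intros n. destruct (Rle_lt_dec (endpoint n D) 0) as [Hn|Hn].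
    - destruct (IVT_gen (endpoint n) d0 D 0) as [d [Hd Hz]].
      + intros x. apply continuity_pt_filterlim. apply endpoint_continuous.
      + pose proof (Hpos n). rewrite Rmin_right, Rmax_left by lra. lra.
      + rewrite Rmin_left, Rmax_right in Hd by lra. now exists d.
    - exists D. split; lra. }
  destruct (functional_choice _ Hroot) as [d Hd].
  destruct (ivp_limit G HG d d0 D ltac:(lra) (fun n => proj1 (Hd n))) as [D' [v [W [HD' [Hend Hs]]]]].
  exists D', v, W. split; [lra|]. split; [easy|].
  assert (Hz : G (fun n => endpoint n (d n) = 0)).
  { apply (ultra_mono G HG _ _) with (2 := H). intros n. apply (Hd n). }
  apply Rle_antisym.
  + apply (ulim_le G HG _ _ _ Hend). apply (ultra_mono G HG _ _) with (2 := Hz). intros n; lra.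
  + apply (ulim_ge G HG _ _ _ Hend). apply (ultra_mono G HG _ _) with (2 := Hz). intros n; lra.
- exfalso.
  destruct (ivp_limit G HG (fun _ => D) D D ltac:(lra) (fun n => conj (Rle_refl _) (Rle_refl _)))
    as [D' [v [W [HD' [Hend Hs]]]]].
  replace D' with D in Hs by lra.
  apply (Hblow v W Hs). apply (ivp_positive D v W); [lra | easy |].
  apply (ulim_ge G HG _ _ _ Hend). apply (ultra_mono G HG _ _) with (2 := H). intros n; lra.
Qed.

End Radial.

(** * From the first-order system to a positive radial solution *)

Lemma continuous_extension (f : R -> R) :
  (forall t, 0 <= t -> filterlim f (within (fun s => 0 <= s) (locally t)) (locally (f t))) ->
  forall x, continuous (fun t => f (Rmax t 0)) x.
Proof.
intros Hf x. apply continuous_of_eps. intros eps Heps.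
pose proof (proj1 (filterlim_locally _ _) (Hf (Rmax x 0) (Rmax_r _ _)) (mkposreal eps Heps)) as [d Hd].
exists d. split; [apply cond_pos|]. intros y Hy.
apply (Hd (Rmax y 0)); [|apply Rmax_r].
apply Rle_lt_trans with (2 := Hy). change (Rabs (Rmax y 0 - Rmax x 0) <= Rabs (y - x)).
unfold Rmax. repeat destruct Rle_dec; unfold Rabs; repeat destruct Rcase_abs; lra.
Qed.

Lemma filterlim_at_right_0 (f b : R -> R) (T : R) : 0 < T -> continuous b 0 -> b 0 = 0 ->
  (forall r, 0 < r < T -> Rabs (f r) <= b r) -> filterlim f (at_right 0) (locally 0).
Proof.
intros HT Hb Hb0 H. apply filterlim_locally. intros eps.
destruct (continuous_eps b 0 eps Hb (cond_pos eps)) as [d [Hd Hc]].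
assert (Hmin : 0 < Rmin d T) by (now apply Rmin_glb_lt).
exists (mkposreal _ Hmin). intros r Hr Hr0.
change (Rabs (r - 0) < Rmin d T) in Hr. change (Rabs (f r - 0) < eps).
assert (Hr1 : Rabs (r - 0) < d) by (eapply Rlt_le_trans; [exact Hr | apply Rmin_l]).
assert (Hr2 : Rabs (r - 0) < T) by (eapply Rlt_le_trans; [exact Hr | apply Rmin_r]).
rewrite Rminus_0_r in *. rewrite Rabs_pos_eq in Hr2 by lra.
specialize (Hc r). rewrite Rminus_0_r, Hb0, Rminus_0_r in Hc.
apply Rle_lt_trans with (b r); [apply H; lra|].
eapply Rle_lt_trans; [apply Rle_abs | now apply Hc].
Qed.

Theorem theorem1p1 (N : nat) (Rad m p alpha beta gamma : R) (a g : R -> R) :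
  (1 <= N)%nat -> 0 < Rad -> 1 < m -> m < INR N -> 1 < p ->
  0 < gamma < m - 1 ->
  (* (H0) *)
  INR N + alpha - m > 0 -> beta - alpha + 1 > 0 ->
  (* (H1) *)
  m - 1 < p -> p < mstar (INR N) m alpha beta gamma - 1 ->
  0 < gamma -> gamma < Upsilon (INR N) m alpha beta ->
  (* (H2) *)
  (forall t, 0 <= t -> 0 <= g t) ->
  (forall t, 0 <= t -> filterlim g (within (fun s => 0 <= s) (locally t)) (locally (g t))) ->
  (forall s t, 0 <= s -> s <= t -> g s <= g t) ->
  is_lim (fun s => g s / s) p_infty 1 ->
  (* (H3) *)
  (forall t, 0 <= t -> 0 < a t) ->
  (forall t, 0 <= t -> filterlim a (within (fun s => 0 <= s) (locally t)) (locally (a t))) ->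
  (exists c1 c2 : R, 0 < c1 /\ c1 <= c2 /\ forall t, 0 <= t -> c1 <= a t <= c2) ->
  exists v : R -> R,
    positive_radial_solution (INR N) m alpha beta gamma p Rad a g v.
Proof.
intros _ HRad Hm _ _ Hga H01 H02 Hp Hsub _ _ Hg0 Hgc Hgm Hglim _ Hac [c1 [c2 [Hc1 [_ Ha]]]].
set (A := INR N + alpha - 1). set (B := INR N + beta - 1). set (e := / (m - 1)).
assert (HA : 0 < A + 1 - m) by (unfold A; lra).
assert (HB : 0 < B + 1 - A) by (unfold A, B; lra).
assert (He : e * (m - 1) = 1) by (unfold e; field; lra).
assert (Hep : 0 < e) by (apply Rinv_0_lt_compat; lra).
assert (HAB : (p + 1 - gamma * e) * (A + 1 - m) < m * (1 - gamma * e) * (B + 1)).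
{ assert (H : p + 1 < mstar (INR N) m alpha beta gamma) by lra. unfold mstar in H.
  assert (Hq : 0 < (m - 1) * (INR N + alpha - m)) by (apply Rmult_lt_0_compat; lra).
  apply (Rmult_lt_compat_r _ _ _ Hq) in H.
  unfold Rdiv in H. rewrite Rmult_assoc, Rinv_l, Rmult_1_r in H by lra.
  apply (Rmult_lt_reg_r (m - 1)); [lra|].
  replace ((p + 1 - gamma * e) * (A + 1 - m) * (m - 1))
    with (((p + 1) * (m - 1) - gamma * (e * (m - 1))) * (A + 1 - m)) by ring.
  replace (m * (1 - gamma * e) * (B + 1) * (m - 1))
    with (m * ((m - 1) - gamma * (e * (m - 1))) * (B + 1)) by ring.
  rewrite He. unfold A, B. lra. }
(* Nothing is known about a and g on the negative axis. *)
set (aa := fun t => a (Rmax t 0)). set (gg := fun t => g (Rmax t 0)).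
assert (Haa : forall r, c1 <= aa r <= c2) by (intros r; apply Ha, Rmax_r).
assert (Hgg0 : forall v, 0 <= gg v) by (intros v; apply Hg0, Rmax_r).
assert (Hggm : forall s t, s <= t -> gg s <= gg t).
{ intros s t Hst. apply Hgm; [apply Rmax_r|]. now apply Rle_max_compat_r. }
assert (Hgglim : is_lim (fun s => gg s / s) p_infty 1).
{ apply is_lim_ext_loc with (2 := Hglim). exists 0. intros x Hx. unfold gg. now rewrite Rmax_left by lra. }
pose proof (continuous_extension a Hac) as Haac. pose proof (continuous_extension g Hgc) as Hggc.
destruct (dirichlet_solution m A B p gamma e (gamma * e) c1 c2 Rad aa gg Hm HA HB Hp Hga He eq_refl HAB
  HRad Hc1 Haa Haac Hgg0 Hggm Hggc Hgglim) as [D [v [W [HD [Hs HvR]]]]].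
set (P := Phi A gamma e aa gg).
assert (HPhi : forall r, 0 <= r <= Rad ->
  0 <= P r (v r) (W r) <= Mc B p gamma e c2 gg D * pw r ((B + 1 - A) * e)).
{ intros r Hr. apply Phi_bound with (m := m) (c1 := c1); try easy.
  - apply (ivp_v_le _ _ _ _ _ _ _ _ _ _ _ Hs r Hr).
  - apply (ivp_W_le _ _ _ _ _ _ _ _ _ _ _ Hs r Hr). }
pose proof (ivp_positive _ _ _ _ _ _ _ _ _ _ _ Hm HA HB Hp Hc1 Haa Hgg0 D v W HD Hs
  (Req_le_sym _ _ HvR)) as Hvpos.
pose proof (ivp_W_pos _ _ _ _ _ _ _ _ _ Hm HA HB Hp D v W HD Hs) as HWpos.
pose proof (ivp_vc _ _ _ _ _ _ _ _ _ _ _ Hs) as Hvc.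
assert (Hdv : forall r, 0 < r < Rad -> is_derive v r (- P r (v r) (W r))) by apply (ivp_dv _ _ _ _ _ _ _ _ _ _ _ Hs).
set (k := (B + 1 - A) * e). assert (Hk : 0 < k) by (apply Rmult_lt_0_compat; lra).
set (C := Mc B p gamma e c2 gg D). assert (HC : 0 <= C) by apply pw_ge0. fold C k in HPhi.
assert (Hbc : forall x, continuous (fun r => C * pw r k) x) by (intros x; now apply continuous_Rscal, continuous_pw).
assert (Hb0 : C * pw 0 k = 0) by (rewrite pw_npos; lra).
set (dv := fun r => if Rle_dec r 0 then 0 else - P r (v r) (W r)).
assert (Hdv_eq : forall r, 0 < r -> dv r = - P r (v r) (W r)).
{ intros r Hr. unfold dv. destruct (Rle_dec r 0); [lra | reflexivity]. }
assert (Hdv0 : dv 0 = 0) by (unfold dv; destruct (Rle_dec 0 0); [reflexivity | lra]).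
assert (Hnear : forall (Q : R -> Prop) r, 0 < r < Rad -> (forall t, 0 < t < Rad -> Q t) -> locally r Q).
{ intros Q r Hr HQ. assert (Hmin : 0 < Rmin r (Rad - r)) by (apply Rmin_glb_lt; lra).
  exists (mkposreal _ Hmin). intros t Ht. apply HQ.
  change (Rabs (t - r) < Rmin r (Rad - r)) in Ht. apply Rabs_lt_between' in Ht.
  pose proof (Rmin_l r (Rad - r)). pose proof (Rmin_r r (Rad - r)). lra. }
(* [Phi] solves the flux relation for the slope, as [e (m - 1) = 1] makes the power [e] invert
   [phi_m]. The flux is therefore [- W], and the differential equation becomes [ivp_dW]. *)
assert (Hflux : forall t, 0 < t < Rad -> flux (INR N) m alpha gamma a g v dv t = - W t).
{ intros t Ht. unfold flux. rewrite Hdv_eq by lra.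
  pose proof (Hvpos t ltac:(lra)) as Hv. pose proof (HWpos t ltac:(lra)) as HW.
  unfold P, Phi, aa, gg. rewrite !Rmax_left by lra. fold A.
  assert (HF : 0 < a t + g (v t)).
  { pose proof (Ha t ltac:(lra)). pose proof (Hg0 (v t) ltac:(lra)). lra. }
  set (X := pw t (- A) * pw (a t + g (v t)) gamma * W t).
  assert (HX : 0 < X) by (repeat apply Rmult_lt_0_compat; try apply pw_pos; lra).
  assert (Hs0 : 0 < pw X e) by (now apply pw_pos).
  assert (Hphi : phi_m m (- pw X e) = - X).
  { unfold phi_m. destruct (Req_EM_T (- pw X e) 0); [lra|].
    rewrite Rabs_Ropp, Rabs_pos_eq, <- pw_Rpower by lra.
    transitivity (- (pw (pw X e) (m - 2) * pw X e)); [ring|]. rewrite <- pw_plus1 by lra.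
    rewrite pw_pw. replace (e * (m - 2 + 1)) with (e * (m - 1)) by ring. rewrite He, pw_x1; lra. }
  rewrite Hphi. rewrite <- !pw_Rpower by lra. unfold X. rewrite pw_opp by lra.
  assert (0 < pw t A) by (apply pw_pos; lra). assert (0 < pw (a t + g (v t)) gamma) by (now apply pw_pos).
  field. split; lra. }
exists v. split; [exact Hvpos|]. exists dv.
split; [intros r Hr; rewrite Hdv_eq by lra; now apply Hdv|].
split.
{ rewrite Hdv0. apply filterlim_at_right_0 with (fun r => C * pw r k) Rad; try easy.
  intros r Hr.
  assert (Hle : forall x, 0 <= x <= r -> pw x k <= pw r k) by (intros; apply pw_le; lra).
  assert (Hdec : v r <= v 0) by (rewrite (ivp_v0 _ _ _ _ _ _ _ _ _ _ _ Hs); apply (ivp_v_le _ _ _ _ _ _ _ _ _ _ _ Hs); lra).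
  (* Integrating the slope bound over [[0, r]] bounds the difference quotient at 0 by [C * r^k],
     which tends to 0 because [k > 0]. *)
  assert (Hinc : v 0 + C * pw r k * 0 <= v r + C * pw r k * r).
  { apply (nondecreasing_of_derive (fun x => v x + C * pw r k * x) (fun x => - P x (v x) (W x) + C * pw r k * 1)).
    - lra.
    - intros x _. apply continuous_Rplus; [apply Hvc | apply continuous_Rscal, continuous_id].
    - intros x Hx. apply is_derive_Rplus; [apply Hdv; lra | apply is_derive_Rscal, is_derive_Rid].
    - intros x Hx. pose proof (HPhi x ltac:(lra)).
      pose proof (Rmult_le_compat_l C _ _ HC (Hle x ltac:(lra))). lra. }
  unfold Rdiv. rewrite Rabs_mult, Rabs_inv, (Rabs_pos_eq r), Rabs_left1 by lra.
  apply (Rmult_le_reg_r r); [lra|]. rewrite Rmult_assoc, Rinv_l by lra. lra. }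
split.
{ intros r Hr. apply continuous_of_eps. intros eps Heps. rewrite Hdv_eq by lra.
  destruct (Phi_eps m A gamma e c1 c2 aa gg Hm He Hc1 Haa Haac Hgg0 Hggc r (v r) (W r) (proj1 Hr) eps Heps)
    as [d [Hd Hc]].
  destruct (continuous_eps v r d (Hvc r) Hd) as [d1 [Hd1 H1]].
  destruct (continuous_eps W r d (ivp_Wc _ _ _ _ _ _ _ _ _ _ _ Hs r) Hd) as [d2 [Hd2 H2]].
  exists (Rmin (Rmin d r) (Rmin d1 d2)). split; [repeat apply Rmin_glb_lt; lra|].
  intros t Ht.
  pose proof (Rmin_l (Rmin d r) (Rmin d1 d2)). pose proof (Rmin_r (Rmin d r) (Rmin d1 d2)).
  pose proof (Rmin_l d r). pose proof (Rmin_r d r). pose proof (Rmin_l d1 d2). pose proof (Rmin_r d1 d2).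
  assert (Ht0 : Rabs (t - r) < r) by lra. apply Rabs_lt_between' in Ht0.
  rewrite Hdv_eq by lra.
  replace (- P t (v t) (W t) - - P r (v r) (W r)) with (- (P t (v t) (W t) - P r (v r) (W r))) by ring.
  rewrite Rabs_Ropp. apply Hc; [lra | apply H1; lra | apply H2; lra]. }
split.
{ rewrite Hdv0. apply filterlim_at_right_0 with (fun r => C * pw r k) Rad; try easy.
  intros r Hr. rewrite Hdv_eq, Rabs_Ropp by lra. pose proof (HPhi r ltac:(lra)).
  rewrite Rabs_pos_eq; lra. }
split; [apply (filterlim_filter_le_1 v (filter_le_within (F := locally Rad) (fun u => u < Rad))), Hvc|].
split; [exact Hdv0|]. split; [exact HvR|].
exists (fun r => - (pw r B * pw (v r) p)). intros r Hr.
split; [|split].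
- apply is_derive_ext_loc with (fun t => - W t).
  + apply Hnear; [exact Hr|]. intros t Ht. symmetry. now apply Hflux.
  + rewrite Rmult_comm. apply (is_derive_opp W). now apply (ivp_dW _ _ _ _ _ _ _ _ _ _ _ Hs).
- apply (continuous_opp (fun r => pw r B * pw (v r) p)), continuous_Rmult.
  + now apply continuous_pw_pos.
  + apply continuous_pw_comp; [lra | apply Hvc].
- pose proof (Hvpos r ltac:(lra)). rewrite !pw_Rpower by lra. unfold B. ring.
Qed.
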